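(* Let $X_1,\ldots,X_n$ be mean zero random variables, and with $W=X_1+\cdots+X_n$, suppose $EW^2=\sigma^2$ exists and is nonzero. For each $i=1,\ldots,n$, assume that there exists a distribution $dF_{n,i}(x_1,\ldots,x_{i-1},x_i',x_i'',x_{i+1},\ldots,x_n)$ on $n+1$ variates $X_1,\ldots,X_{i-1},X_i',X_i'',X_{i+1},\ldots,X_n$ such that $$(X_1,\ldots,X_{i-1},X_i',X_i'',X_{i+1},\ldots,X_n)\stackrel{d}{=}(X_1,\ldots,X_{i-1},X_i'',X_i',X_{i+1},\ldots,X_n),\qquad (\mathrm{a})$$ $$(X_1,\ldots,X_{i-1},X_i,X_{i+1},\ldots,X_n)\stackrel{d}{=}(X_1,\ldots,X_{i-1},X_i',X_{i+1},\ldots,X_n).\qquad (\mathrm{b})$$ Suppose further that there is a $\rho$ such that for all $f$ for which $EWf(W)$ exists, $$\sum_{i=1}^n E X_i'f(W_i+X_i'')=\rho\,EWf(W),\qquad (\mathrm{c})$$ where $W_i=W-X_i$. Set $v_i^2=E(X_i'-X_i'')^2$. Let $I$ be a random index independent of the $X$'s such that $$P(I=i)=v_i^2\Big/\sum_{j=1}^n v_j^2.$$ Further, for $i$ such that $v_i>0$, let $\hat X_1,\ldots,\hat X_{i-1},\hat X_i',\hat X_i'',\hat X_{i+1},\ldots,\hat X_n$ be chosen according to the distribution $$d\hat F_{n,i}(\hat x_1,\ldots,\hat x_{i-1},\hat x_i',\hat x_i'',\hat x_{i+1},\ldots,\hat x_n)=\frac{(\hat x_i'-\hat x_i'')^2}{v_i^2}\,dF_{n,i}(\hat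 x_1,\ldots,\hat x_{i-1},\hat x_i',\hat x_i'',\hat x_{i+1},\ldots,\hat x_n).$$ Put $\hat W_i=\sum_{j\ne i}\hat X_j$. Then, with $U$ a uniform variate on $[0,1]$ which is independent of the $X$'s and the index $I$, $$U\hat X_I'+(1-U)\hat X_I''+\hat W_I$$ has the $W$-zero biased distribution. In particular, when $X_1,\ldots,X_n$ (mean zero, with $EW^2=\sigma^2$ existing and nonzero) are exchangeable, if one constructs exchangeable variables $X_1',X_1'',X_2,\ldots,X_n$ with distribution $dF_{n,1}$ which satisfy $v_1^2>0$, condition (b) for $i=1$, and, for some $\rho$, $$E\{X_1'\mid W_1+X_1''\}=\frac{\rho}{n}(W_1+X_1''),$$ then $$U\hat X_1'+(1-U)\hat X_1''+\hat W_1$$ has the $W$-zero biased distribution, where $(\hat X_1',\hat X_1'',\hat X_2,\ldots,\hat X_n)$ has the distribution $d\hat F_{n,1}$ given above with $i=1$.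
   Context: For a mean zero random variable $W$ with finite, nonzero variance $\sigma^2$, a random variable $W^*$ has the $W$-zero biased distribution if $E[Wf(W)]=\sigma^2E[f'(W^* )]$ for all differentiable $f$ for which $EWf(W)$ exists. For each $i$, the collection $X_1,\ldots,X_{i-1},X_i',X_i'',X_{i+1},\ldots,X_n$ denotes variates with joint distribution $dF_{n,i}$; $\hat W_i$ is formed from the hatted collection with distribution $d\hat F_{n,i}$. The symbol $\stackrel{d}{=}$ denotes equality in distribution.
   Formalization: The zero-bias identity is asserted for differentiable f for which both EWf(W) and Ef'(W* ) exist; without the latter it fails, e.g. f(x)=x² sin(1/x²) with W bounded, where Ef'(W* ) is undefined. Finiteness of each v_i², implicit in the text, is stated. *)

(* Defs.v *)
From HB Require Import structures.
From mathcomp Require Import all_boot all_order all_algebra perm.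
From mathcomp Require Import all_classical all_reals all_analysis.
Import Order.TTheory GRing.Theory Num.Theory.
Import numFieldNormedType.Exports.

Set Implicit Arguments.
Unset Strict Implicit.
Unset Printing Implicit Defensive.

Local Open Scope classical_set_scope.
Local Open Scope ring_scope.

Section laws.
Context (R : realType).

(* Equality in distribution. The two pushforwards are compared on measurable
   sets only: a measure is a total function on [set T], so equality as
   functions would also constrain its values on non-measurable sets. *)
Definition same_law d1 d2 d (T1 : measurableType d1) (T2 : measurableType d2)
    (S : measurableType d) (P : probability T1 R) (Q : probability T2 R)
    (X : T1 -> S) (Y : T2 -> S) : Prop :=
  forall A : set S, measurable A -> pushforward P X A = pushforward Q Y A.

Definition exchangeable d (T : measurableType d) (P : probability T R) (m : nat)
    (Y : 'I_m -> T -> R) : Prop :=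
  forall s : {perm 'I_m},
    same_law P P (fun w => [tuple Y (s k) w | k < m])
                 (fun w => [tuple Y k w | k < m]).

(* Independence of two sigma-algebras (given as systems of events). *)
Definition indep_systems d (T : measurableType d) (P : probability T R)
    (G H : set_system T) : Prop :=
  forall A B : set T, G A -> H B -> (P (A `&` B) = P A * P B)%E.

(* h o Z is a version of the conditional expectation E{X | Z}. *)
Definition is_cond_expectation d (T : measurableType d) (P : probability T R)
    (X Z : T -> R) (h : R -> R) : Prop :=
  [/\ measurable_fun [set: R] h,
      P.-integrable [set: T] (EFin \o X),
      P.-integrable [set: T] (EFin \o (h \o Z)) &
      forall B : set R, measurable B ->
        (\int[P]_(w in Z @^-1` B) (X w)%:E
         = \int[P]_(w in Z @^-1` B) (h (Z w))%:E)%E].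

(* Ws has the W-zero biased distribution, for W of mean zero and finite nonzero
   variance. The identity is required of every everywhere differentiable f for
   which both expectations exist: differentiability of f and integrability of
   W f(W) do not make f'(Ws) integrable: with f(x) = x^2 sin(1/x^2) and W bounded,
   E f'(Ws) fails to exist as soon as Ws has a density bounded below near 0. *)
Definition zero_biased d d' (T : measurableType d) (T' : measurableType d')
    (P : probability T R) (P' : probability T' R)
    (W : T -> R) (Ws : T' -> R) : Prop :=
  measurable_fun [set: T'] Ws /\
  forall f : R -> R,
    (forall x : R, derivable f x 1) ->
    P.-integrable [set: T] (EFin \o (fun w => W w * f (W w))) ->
    P'.-integrable [set: T'] (EFin \o (fun w => derive1 f (Ws w))) ->
    ('E_P[fun w => (W w * f (W w))%R]
     = 'V_P[W] * 'E_P'[fun w => derive1 f (Ws w)])%E.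

End laws.

(* A collection (x_1, ..., x_{i-1}, x_i', x_i'', x_{i+1}, ..., x_n) is an
   (n+1)-tuple t listed in this order. With indices starting at 0, x_i' is entry
   i and x_i'' is entry i+1. *)
Section collections.
Context (R : realType) (n : nat).
Implicit Types (i j : 'I_n) (t : n.+1.-tuple R).

Definition pos1 i : 'I_n.+1 := widen_ord (leqnSn n) i.
Definition pos2 i : 'I_n.+1 := lift ord0 i.

Definition x1 i t : R := tnth t (pos1 i).
Definition x2 i t : R := tnth t (pos2 i).

(* (x_1, ..., x_{i-1}, x_i'', x_i', x_{i+1}, ..., x_n) *)
Definition swap i t : n.+1.-tuple R :=
  [tuple tnth t (tperm (pos1 i) (pos2 i) k) | k < n.+1].

(* (x_1, ..., x_{i-1}, x_i', x_{i+1}, ..., x_n): [lift (pos2 i)] enumerates the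
   positions other than that of x_i''. *)
Definition drop2 i t : n.-tuple R := [tuple tnth t (lift (pos2 i) j) | j < n].

(* sum of the x_j over j <> i *)
Definition rest i t : R := \sum_(j < n | j != i) tnth (drop2 i t) j.

Definition mix i (u : R) t : R := u * x1 i t + (1 - u) * x2 i t + rest i t.

Definition vsq (F : probability (n.+1.-tuple R) R) i : R :=
  fine 'E_F[fun t => ((x1 i t - x2 i t) ^+ 2)%R]%E.

(* the distribution (x_i' - x_i'')^2 / v_i^2 dF *)
Definition hat_law (F : probability (n.+1.-tuple R) R) i
    (A : set (n.+1.-tuple R)) : \bar R :=
  (\int[F]_(t in A) ((x1 i t - x2 i t) ^+ 2 / vsq F i)%:E)%E.

End collections.

(* Main.v *)
Require Import Defs.
From HB Require Import structures.
From mathcomp Require Import all_boot all_order all_algebra perm.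
From mathcomp Require Import all_classical all_reals all_analysis.
From mathcomp Require Import measurable_realfun ring lra.
Import Order.TTheory GRing.Theory Num.Theory.
Import numFieldNormedType.Exports.

Set Implicit Arguments.
Unset Strict Implicit.
Unset Printing Implicit Defensive.

(** Write [W_i] for [rest i], and [phi = ramp a b] for the bounded primitive of the
    indicator function of an interval `]a, b]`.

    Let [i] be fixed. Conditionally on the hatted collection,
    [u x_i' + (1 - u) x_i'' + W_i] is uniform on the segment from [W_i + x_i''] to
    [W_i + x_i'], so the mean of [phi'] along it is
    [(phi(W_i + x_i') - phi(W_i + x_i'')) / (x_i' - x_i'')]. The weight
    [(x_i' - x_i'')^2 / v_i^2] of the hatted law turns this into
    [(x_i' - x_i'') (phi(W_i + x_i') - phi(W_i + x_i'')) / v_i^2] under the original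
    law ([law_mix]), and the factor [v_i^2] is restored by the law of the index [I].
    Exchangeability of [x_i'] and [x_i''] makes the expectation of that product
    [2 (E x_i' phi(W_i + x_i') - E x_i' phi(W_i + x_i''))]
    ([integral_exchangeable_pair]). By condition (b) the first terms sum to
    [E W phi(W)], and by condition (c) the second ones sum to [rho E W phi(W)]. Hence,
    with [Ws] the mixture and [S] the sum of the [v_i^2],
    [S P(a < Ws <= b) = 2 (1 - rho) E W phi(W)] for all [a <= b].

    It remains to see that this family of identities characterizes zero biasing
    ([zero_biased_of_itv]). As [E W = 0], [E W phi(W)] is
    [E W (phi(W) - phi(0)) = E (W^2 \int_0^1 phi'(u W) du)]; so both sides are finite
    measures of the interval. Letting the interval grow gives
    [S = 2 (1 - rho) E W^2], and by uniqueness of measures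
    [E W^2 E g(Ws) = E (W^2 \int_0^1 g(u W) du)] for every Borel [g] that is
    nonnegative or makes [g(Ws)] integrable. For [g = f'] the right-hand side is
    [E W (f(W) - f(0)) = E W f(W)].

    The last step is delicate, because [f] is merely differentiable everywhere: [f']
    may be discontinuous and even fail to be locally integrable. Fubini's theorem
    makes it integrable on almost every segment that matters, and an everywhere
    differentiable function whose derivative is Lebesgue integrable satisfies the
    fundamental theorem of calculus ([integral_derive1]).

    For exchangeable [X_i] one pair suffices: [E X_1 phi(W) = E W phi(W) / n], and the
    regression hypothesis gives
    [E x_1' phi(W_1 + x_1'') = (rho / n) E W phi(W)] once it is extended from
    indicators to bounded functions ([cond_expectation_mul]), because [W_1 + x_1'']
    has the law of [W]. *)

Local Open Scope classical_set_scope.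
Local Open Scope ring_scope.

(** * The fundamental theorem of calculus for everywhere differentiable functions *)

Section ftc.
Context {R : realType}.
Implicit Types (G h g C Psi : R -> R) (a b x : R).
Local Notation mu := (@lebesgue_measure R).

Lemma derive1_gt0_near_right G x : derivable G x 1 -> 0 < derive1 G x ->
  \forall t \near x^'+, G x <= G t.
Proof.
move=> dG dG0.
have G0 : h^-1 *: (G (h + x) - G x) @[h --> 0^'] --> derive1 G x.
  rewrite derive1E; move: dG; rewrite /derivable /derive.
  by under eq_fun do rewrite /= [_ *: 1]mulr1.
have : \forall h \near 0^', 0 < h^-1 *: (G (h + x) - G x).
  exact: (cvgr_gt _ G0 _ dG0).
rewrite near_withinE => /nbhs_ballP[e /= e0 He].
near=> t.
have xt : x < t by near: t; exact: nbhs_right_gt.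
have te : t - x < e by rewrite ltrBlDl; near: t; apply: nbhs_right_lt; rewrite ltrDl.
have := He (t - x).
rewrite /ball /= sub0r normrN gtr0_norm ?subr_gt0// => /(_ te).
rewrite gt_eqF ?subr_gt0// => /(_ isT).
by rewrite subrK /GRing.scale/= pmulr_rgt0 ?invr_gt0 ?subr_gt0// => /ltW.
Unshelve. all: by end_near. Qed.

(** Local growth to the right propagates: the supremum of the points of `[a, b]`
    at which the function is at least its value at [a] satisfies the same
    inequality, because passing to the limit from the left only needs
    [C] continuous and [Psi] nondecreasing; local growth forbids it to be less
    than [b]. Allowing a nondecreasing, possibly discontinuous summand is what
    makes the correction at a null set possible below. *)
Lemma le_of_near_right C Psi a b : a <= b ->
  {in `[a, b], continuous C} -> {homo Psi : x y / x <= y} ->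
  (forall x, a <= x < b -> \forall t \near x^'+, C x + Psi x <= C t + Psi t) ->
  C a + Psi a <= C b + Psi b.
Proof.
move=> ab cC ndPsi grow.
pose S := [set x | a <= x <= b /\ C a + Psi a <= C x + Psi x].
have Sa : S a by split; rewrite ?lexx.
have hS : has_sup S.
  by split; [exists a|exists b => x [/andP[]]].
set s := sup S.
have as_ : a <= s by exact: ub_le_sup (hS.2) _ Sa.
have sb : s <= b by apply: ge_sup; [exists a|move=> x [/andP[]]].
have Ss : C a + Psi a <= C s + Psi s.
  apply/ler_addgt0Pr => e e0.
  have /cvgrPdist_lt/(_ _ e0)/nbhs_ballP[r /= r0 Hr] : {for s, continuous C}.
    by apply: cC; rewrite in_itv/= as_.
  have [y [/andP[ay yb] Sy] ys] := sup_adherent r0 hS.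
  have ys' : y <= s by apply: ub_le_sup hS.2 _ _; split => //; exact/andP.
  have : `|C s - C y| < e.
    by apply: Hr; rewrite /ball/= ger0_norm ?subr_ge0// ltrBlDr -ltrBlDl.
  have := ndPsi _ _ ys'.
  by move=> + /[1!distrC]/ltr_normlW; move: Sy; lra.
have [sb'|] := ltP s b; last first.
  by move=> bs; have -> : b = s by apply/eqP; rewrite eq_le bs sb.
have := grow s; rewrite as_ sb' => /(_ isT) g.
have [t [st tb Ct]] : exists t, [/\ s < t, t < b & C s + Psi s <= C t + Psi t].
  near s^'+ => t; exists t; split.
  - by near: t; exact: nbhs_right_gt.
  - by near: t; exact: nbhs_right_lt.
  - by near: t.
have : t <= s.
  apply: ub_le_sup hS.2 _ _; split; last exact: le_trans Ct.
  by rewrite (ltW tb) (le_trans as_ (ltW st)).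
by rewrite leNgt st.
Unshelve. all: by end_near. Qed.

Lemma null_set_small_open (g : R -> R) (N : set R) (e : R) :
  mu.-integrable setT (EFin \o g) -> measurable N -> mu N = 0%E -> 0 < e ->
  exists V : set R, [/\ open V, N `<=` V &
    (\int[mu]_(x in V) (1 + `|g x|)%:E <= e%:E)%E].
Proof.
move=> ig mN N0 e0.
have mg : measurable_fun setT g by apply/measurable_EFinP; case/integrableP: ig.
have e20 : 0 < e / 2 by rewrite divr_gt0.
have [d [d0 Hd]] := integral_normr_continuous ig e20.
have d'0 : 0 < Num.min d (e / 2) by rewrite lt_min d0.
have Nlty : (mu N < +oo)%E by rewrite N0 ltry.
have [V [oV NV mVN]] := lebesgue_regularity_outer mN Nlty d'0.
have mV : measurable V := open_measurable oV.
have {mVN}mVlt : (mu V < (Num.min d (e / 2))%:E)%E.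
  by rewrite -(setDUK NV) setUC measureU0//; exact: measurableD.
exists V; split => //.
under eq_integral do rewrite EFinD.
rewrite ge0_integralD//=; last first.
  by apply/measurable_EFinP/measurable_funTS; exact: measurableT_comp.
rewrite integral_cst// mul1e.
have iV : mu.-integrable V (EFin \o g) by exact: integrableS ig.
have -> : (\int[mu]_(x in V) `|g x|%:E = (\int[mu]_(x in V) `|g x|)%R%:E)%E.
  rewrite fineK//; apply: integrable_fin_num => //.
  exact: (integrable_abse iV).
rewrite (splitr e) EFinD leeD//.
- by rewrite (le_trans (ltW mVlt))// lee_fin ge_min lexx orbT.
- rewrite lee_fin ltW// Hd// (lt_le_trans mVlt)// lee_fin ge_min lexx//.
Qed.

(** By Lebesgue's differentiation theorem the indefinite integral [Phi] of [h']
    has derivative [h'] outside a null set [N]. The problem is [N], where [h] has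
    a finite derivative but [Phi] is uncontrolled. Cover [N] by open sets [V k]
    so small that the series [Psi x] of the integrals of [1 + `|h'|] over
    [V k `&` `]-oo, x]] stays below [e / 2]. To the right of a point of [N] the
    increments of [Psi] eventually dominate any multiple of those of
    [\int (1 + `|h'|)], hence both the variation of [Phi] and the growth of [h].
    So [Phi - h + Psi], tilted by a small slope [eta], grows to the right at
    every point, on [N] thanks to [Psi] and off [N] thanks to [eta]. *)
Lemma derivable_le_integral h a b : a < b -> (forall x, derivable h x 1) ->
  mu.-integrable `[a, b] (EFin \o derive1 h) ->
  h b - h a <= (\int[mu]_(t in `[a, b]) derive1 h t)%R.
Proof.
move=> ab dh ih.
have mab : measurable (`[a, b]%classic : set R) by exact: measurable_itv.
pose g := derive1 h \_ `[a, b].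
have ig : mu.-integrable setT (EFin \o g).
  by rewrite -restrict_EFin; apply/integrable_restrict => //=; rewrite setTI.
have ig' (A : set R) : measurable A -> mu.-integrable A (EFin \o g).
  by move=> mA; exact: integrableS ig.
have mg : measurable_fun setT g by apply/measurable_EFinP; case/integrableP: ig.
(* starting at [a - 1] makes [a] an interior point for the differentiation
   theorem; [g] vanishes on the added piece *)
pose Phi x := (\int[mu]_(t in `[a - 1, x]) g t)%R.
have cPhi x : x \in `[a, b] -> {for x, continuous Phi}.
  rewrite in_itv/= => /andP[ax xb].
  apply: (@within_continuous_continuous _ _ _ (a - 1) (b + 1)).
  - by lra.
  - apply: parameterized_integral_continuous; first by lra.
    by apply: ig'; exact: measurable_itv.
  - by rewrite in_itv/=; apply/andP; split; lra.
have dPhi := FTC1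
  (fun y => ig' _ (measurable_itv (Interval (BLeft (a - 1)) (BRight y))))
  (open_integrable_locally openT ig).
have PhiB x t : a <= x -> x <= t ->
    Phi t - Phi x = (\int[mu]_(y in `]x, t]) g y)%R.
  move=> ax xt; apply: Rintegral_itvB; first by apply: ig'; exact: measurable_itv.
  - by rewrite bnd_simp; lra.
  - by rewrite bnd_simp.
have -> : (\int[mu]_(t in `[a, b]) derive1 h t)%R = Phi b - Phi a.
  rewrite PhiB ?(ltW ab)// Rintegral_itv_obnd_cbnd; last first.
    by apply: ig'; exact: measurable_itv.
  by apply: eq_Rintegral => x xab; rewrite /g patchE xab.
have [N [mN N0 HN]] := dPhi.
have {HN}HN x : a <= x -> ~ N x -> derivable Phi x 1 /\ derive1 Phi x = g x.
  move=> ax Nx; apply: contrapT => H; apply: Nx; apply: HN => /= K; apply: H.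
  by apply: K; rewrite /= ?lte_fin ?bnd_simp; lra.
apply/ler_addgt0Pr => e e0.
have e20 : 0 < e / 2 by rewrite divr_gt0.
have ek (k : nat) : 0 < e / 2 / (2 ^ k.+1)%:R by rewrite divr_gt0// ltr0n expn_gt0.
have exV : forall k, exists V : set R, [/\ open V, N `<=` V &
    (\int[mu]_(x in V) (1 + `|g x|)%:E <= (e / 2 / (2 ^ k.+1)%:R)%:E)%E].
  by move=> k; exact: null_set_small_open (ek k).
have [V HV] := choice exV.
have oV k : open (V k) by have [] := HV k.
have mV k : measurable (V k) by exact: open_measurable.
pose m A := (\int[mu]_(x in A) (1 + `|g x|)%:E)%E.
have m0 A : (0 <= m A)%E by apply: integral_ge0 => x _; rewrite lee_fin addr_ge0.
have mg1 (A : set R) : measurable_fun A (fun x => (1 + `|g x|)%:E).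
  apply/measurable_EFinP/measurable_funTS/measurable_funD => //.
  exact: measurableT_comp.
have mle (A B : set R) : measurable A -> measurable B -> A `<=` B -> (m A <= m B)%E.
  move=> mA mB AB; rewrite /m; apply: ge0_subset_integral => //; exact: mg1.
pose s x := (\sum_(0 <= k <oo) m (V k `&` `]-oo, x]))%E.
have mVI k (i : interval R) : measurable (V k `&` [set` i]).
  by apply: measurableI => //; exact: measurable_itv.
have s_le x : (s x <= (e / 2)%:E)%E.
  apply: le_trans (epsilon_trick0 xpredT (ltW e20)).
  apply: lee_nneseries => [k _ _|k _]; first exact: m0.
  by have [_ _ +] := HV k; apply: le_trans; apply: mle.
have s_ge0 x : (0 <= s x)%E by apply: nneseries_ge0.
have s_fin x : s x \is a fin_num.
  by rewrite ge0_fin_numE// (le_lt_trans (s_le x)) ?ltry.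
pose Psi x := fine (s x).
have sD x t : x <= t -> (s t = s x + \sum_(0 <= k <oo) m (V k `&` `]x, t]))%E.
  move=> xt; rewrite /s -nneseriesD//; apply: eq_eseriesr => k _.
  rewrite /m -ge0_integral_setU//.
  - by rewrite -setIUr -itv_bndbnd_setU.
  - exact: (mVI k `]-oo, x]).
  - exact: (mVI k `]x, t]).
  - exact: mg1.
  - apply/disj_setPLR => y [_ /=]; rewrite in_itv/= => yx [_ /=].
    by rewrite in_itv/= ltNge yx.
clearbody s.
have PsiD x t (M : nat) : x <= t -> (forall k, (k < M)%N -> `]x, t] `<=` V k) ->
    Psi x + M%:R * ((t - x) + (\int[mu]_(y in `]x, t]) `|g y|)%R) <= Psi t.
  move=> xt HM.
  have mxt : m `]x, t]%classic =
      ((t - x) + (\int[mu]_(y in `]x, t]) `|g y|)%R)%:E.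
    rewrite /m; under eq_integral do rewrite EFinD.
    rewrite ge0_integralD//=; last first.
      by apply/measurable_EFinP/measurable_funTS; exact: measurableT_comp.
    have ixt : mu.-integrable `]x, t] (EFin \o g) by apply: ig'; exact: measurable_itv.
    rewrite integral_cst//= mul1e EFinD lebesgue_measure_itv/= lte_fin.
    rewrite fineK; last first.
      by apply: integrable_fin_num => //; exact: (integrable_abse ixt).
    case: ltgtP xt => [xt _|//|-> _]; first by rewrite EFinB.
    by rewrite subrr.
  rewrite -lee_fin EFinD (fineK (s_fin x)) (fineK (s_fin t)) (sD x t xt).
  apply: leeD2l.
  apply: le_trans (nneseries_lim_ge M _); last by [].
  rewrite big_nat (eq_bigr (fun=> m `]x, t]%classic)); last first.
    by move=> k /= kM; rewrite setIidr//; exact: HM.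
  by rewrite -big_nat mxt sumEFin sumr_const_nat subn0 -[in leRHS]mulr_natl.
have Psi_le : Psi b <= e / 2 by rewrite -lee_fin (fineK (s_fin _)).
have Psi_ge0 : 0 <= Psi a by rewrite -lee_fin (fineK (s_fin _)).
have ndPsi : {homo Psi : x y / x <= y}.
  by move=> x y xy; have := @PsiD x y 0 xy; rewrite mul0r addr0; apply.
clearbody Phi Psi.
pose eta := e / 2 / (b - a).
have eta0 : 0 < eta by rewrite divr_gt0// subr_gt0.
pose C t := Phi t - h t + eta * t.
have : C a + Psi a <= C b + Psi b.
  apply: (le_of_near_right (ltW ab) _ ndPsi) => [x xab|x /andP[ax xb]].
    apply: cvgD; last by apply: cvgM; [exact: cvg_cst|exact: cvg_id].
    apply: cvgB; first exact: cPhi.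
    by apply: differentiable_continuous; apply/derivable1_diffP.
  have dhx : is_derive x 1 h (derive1 h x) by rewrite derive1E; split.
  have [Nx|Nx] := pselect (N x).
  - (* [M] exceeds 1, to absorb the variation of [Phi], and [h' x + 1], to absorb
       the growth of [h] *)
    pose M := Num.bound (`|derive1 h x| + 1).
    have hM : `|derive1 h x| + 1 < M%:R by apply: archi_boundP; rewrite addr_ge0.
    have nV : \forall t \near x^'+, forall k : 'I_M, `]x, t] `<=` V k.
      apply: filter_forall => k.
      have /nbhs_ballP[r /= r0 Hr] : nbhs x (V k).
        by apply: open_nbhs_nbhs; split; [exact: oV|have [_ + _] := HV k; exact].
      near=> t => y /=; rewrite in_itv/= => /andP[xy yt]; apply: Hr.
      rewrite /ball/= ltr0_norm ?subr_lt0// opprB ltrBlDl (le_lt_trans yt)//.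
      by near: t; apply: nbhs_right_lt; rewrite ltrDl.
    have nh : \forall t \near x^'+,
        (derive1 h x + 1) * x - h x <= (derive1 h x + 1) * t - h t.
      have dG : is_derive x 1 (fun t => (derive1 h x + 1) * t - h t) 1.
        by apply: is_derive_eq; rewrite /GRing.scale/=; ring.
      apply: derive1_gt0_near_right => //.
      by rewrite derive1E derive_val.
    near=> t.
    have xt : x < t by near: t; exact: nbhs_right_gt.
    have /(PsiD x t M (ltW xt)) : forall k, (k < M)%N -> `]x, t] `<=` V k.
      move=> k kM; suff /(_ (Ordinal kM)) : forall k : 'I_M, `]x, t] `<=` V k by [].
      by near: t.
    have hh : (derive1 h x + 1) * x - h x <= (derive1 h x + 1) * t - h t by near: t.
    have ixt : mu.-integrable `]x, t] (EFin \o g) by apply: ig'; exact: measurable_itv.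
    have : `|(\int[mu]_(y in `]x, t]) g y)%R| <= (\int[mu]_(y in `]x, t]) `|g y|)%R.
      by apply: le_normr_Rintegral ixt; exact: measurable_itv.
    rewrite -(PhiB _ _ ax (ltW xt)) => /ler_normlP[+ _].
    have : 0 <= (\int[mu]_(y in `]x, t]) `|g y|)%R by exact: Rintegral_ge0.
    set G := (\int[mu]_(y in _) `|_|)%R => G0 PhiG PsiM.
    have M1 : 1 <= M%:R :> R by rewrite (le_trans _ (ltW hM))// lerDr.
    have Mh : derive1 h x + 1 <= M%:R.
      by rewrite (le_trans _ (ltW hM))// lerD2r ler_norm.
    have MG : 0 <= (M%:R - 1) * G by rewrite mulr_ge0// subr_ge0.
    have Mt : 0 <= (M%:R - (derive1 h x + 1)) * (t - x).
      by rewrite mulr_ge0// subr_ge0// ltW.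
    have et : 0 <= eta * (t - x) by rewrite mulr_ge0 ?(ltW eta0)// subr_ge0 ltW.
    by rewrite /C; move: MG Mt et hh PhiG PsiM; clear; lra.
  - have [dPx Px] := HN x ax Nx.
    have Pgx : derive1 Phi x = derive1 h x.
      by rewrite Px /g patchE mem_set//= in_itv/= ax ltW.
    have dP : is_derive x 1 Phi (derive1 h x) by rewrite -Pgx derive1E; split.
    have dC : is_derive x 1 C eta.
      by apply: is_derive_eq; rewrite /GRing.scale/=; ring.
    have : \forall t \near x^'+, C x <= C t.
      apply: derive1_gt0_near_right; first exact: (@ex_derive _ _ _ _ _ _ _ dC).
      by rewrite derive1E (@derive_val _ _ _ _ _ _ _ dC).
    apply: filter_app; near=> t => Ct; apply: (lerD Ct); apply: ndPsi.
    by apply: ltW; near: t; exact: nbhs_right_gt.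
have : eta * (b - a) = e / 2 by rewrite /eta divfK// gt_eqF// subr_gt0.
by rewrite /C; move: (Phi b) (Phi a) Psi_le Psi_ge0 => *; lra.
Unshelve. all: by end_near. Qed.

(** The inequality, applied to [h] and to [- h]. The point is that [h'] may be
    discontinuous and unbounded, so that neither Riemann sums nor Lebesgue's
    differentiation theorem alone suffice. *)
Theorem integral_derive1 h a b : a < b -> (forall x, derivable h x 1) ->
  mu.-integrable `[a, b] (EFin \o derive1 h) ->
  (\int[mu]_(t in `[a, b]) derive1 h t)%R = h b - h a.
Proof.
move=> ab dh ih; apply/eqP; rewrite eq_le derivable_le_integral// andbT.
have dN : derive1 (- h) = - derive1 h.
  by apply/funext => x; rewrite derive1E deriveN//= fctE derive1E.
have ihN : mu.-integrable `[a, b] (EFin \o derive1 (- h)).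
  have -> : EFin \o derive1 (- h) = -%E \o (EFin \o derive1 h) by rewrite dN.
  by apply: integrableN => //; exact: measurable_itv.
have := derivable_le_integral ab (fun x => derivableN (dh x)) ihN.
have -> : (\int[mu]_(t in `[a, b]) derive1 (- h) t)%R
    = - (\int[mu]_(t in `[a, b]) derive1 h t)%R.
  rewrite -[RHS]mulN1r -RintegralZl//.
  by apply: eq_Rintegral => t _; rewrite mulN1r dN.
by rewrite !fctE; lra.
Qed.
End ftc.

Lemma measurable_derive1 (R : realType) (f : R -> R) :
  (forall x, derivable f x 1) -> measurable_fun setT (derive1 f).
Proof.
move=> df.
have mf : measurable_fun setT f.
  apply: continuous_measurable_fun => x.
  by apply: differentiable_continuous; exact/derivable1_diffP.
pose q (n : nat) x := n.+1%:R * (f (n.+1%:R^-1 + x) - f x).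
apply: (@measurable_fun_cvg _ _ _ _ q) => [n|x _].
  apply: measurable_funM => //; apply: measurable_funB => //.
  by apply: (measurableT_comp mf); apply: measurable_funD.
have fx : h^-1 *: (f (h + x) - f x) @[h --> 0^'+] --> derive1 f x.
  apply: cvg_dnbhs_at_right; rewrite derive1E.
  have := df x; rewrite /derivable /derive.
  by under eq_fun do rewrite /= [_ *: 1]mulr1.
have -> : q^~ x = fun n => (n.+1%:R^-1)^-1 *: (f (n.+1%:R^-1 + x) - f x).
  by apply/funext => n; rewrite invrK.
apply: ((cvg_at_rightP _ _ _).1 fx (fun n => n.+1%:R^-1)); split.
  by move=> n; rewrite invr_gt0.
exact: cvg_harmonic.
Qed.

(** * Averages along segments *)

Section uniform.
Context {R : realType}.
Implicit Types (a b c e s r x y : R).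
Local Notation mu := (@lebesgue_measure R).
Local Notation U := (uniform_prob (@ltr01 R)).

Lemma uniform01E (A : set R) : measurable A -> U A = mu (A `&` `[0, 1]).
Proof.
move=> mA; rewrite -[in LHS](setIT A) -(integral_indic U measurableT mA).
rewrite integral_uniform//=.
- by rewrite subr0 invr1 mul1e integral_indic.
- by apply/measurable_EFinP; exact: measurable_indic.
Qed.

Lemma uniform01_gt r : U `]r, +oo[ = (Num.max 0 (1 - Num.max r 0))%:E.
Proof.
rewrite uniform01E; last exact: measurable_itv.
have [r0|r0] := ltP r 0.
- rewrite (_ : _ `&` _ = `[0, 1]%classic).
    by rewrite lebesgue_measure_itv/= lte_fin ltr01 -EFinB !subr0 max_r.
  apply/seteqP; split => [x []//|x /=].
  by rewrite !in_itv/= andbT => /andP[x0 ->]; rewrite x0 (lt_le_trans r0 x0).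
- rewrite (_ : _ `&` _ = `]r, 1]%classic).
    rewrite lebesgue_measure_itv/= lte_fin -EFinB.
    by rewrite maxEle; case: ifPn; case: ifPn; rewrite -?ltNge => *; congr EFin; lra.
  apply/seteqP; split => x /=; rewrite !in_itv/= andbT.
    by move=> [-> /andP[_ ->]].
  by move=> /andP[rx ->]; rewrite rx (le_trans r0 (ltW rx)).
Qed.

Lemma uniform01_lt r : U `]-oo, r[ = (Num.max 0 (Num.min r 1))%:E.
Proof.
rewrite uniform01E; last exact: measurable_itv.
have [r1|r1] := leP r 1.
- rewrite (_ : _ `&` _ = `[0, r[%classic).
    rewrite lebesgue_measure_itv/= lte_fin -EFinB subr0.
    by case: ltgtP => // [r0|->]; rewrite ?maxxx// max_r// ltW.
  apply/seteqP; split => x /=; rewrite !in_itv/=.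
    by move=> [-> /andP[-> _]].
  by move=> /andP[x0 xr]; rewrite xr x0 (le_trans (ltW xr)).
- rewrite (_ : _ `&` _ = `[0, 1]%classic).
    by rewrite lebesgue_measure_itv/= lte_fin ltr01 -EFinB subr0 max_r.
  apply/seteqP; split => [x []//|x /=].
  by rewrite !in_itv/= => /andP[-> x1]; rewrite x1 (le_lt_trans x1 r1).
Qed.

(** The bounded primitive, vanishing before [a], of the indicator function of
    `]a, b]`. These are the test functions of the whole proof: bounded, so that no
    integrability question arises, and with derivatives that generate the Borel
    sets. *)
Definition ramp a b x : R := Num.max (x - a) 0 - Num.max (x - b) 0.

Lemma uniform_halfline e c s :
  c * fine (U [set u | s < u * c + e]) =
  Num.max (e + c - s) 0 - Num.max (e - s) 0.
Proof.
have [c0|c0|->] := ltgtP c 0.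
- rewrite (_ : [set _ | _] = `]-oo, ((s - e) / c)[%classic); last first.
    apply/seteqP; split => x /=; rewrite in_itv/=.
      by rewrite -ltrBlDr ltr_ndivlMr.
    by rewrite -ltrBlDr ltr_ndivlMr.
  rewrite uniform01_lt/=; set r := _ / c.
  have -> : s = e + r * c by rewrite /r divfK ?lt_eqF//; ring.
  by rewrite !maxEle !minEle; repeat case: ifPn; rewrite -?ltNge; nra.
- rewrite (_ : [set _ | _] = `]((s - e) / c), +oo[%classic); last first.
    apply/seteqP; split => x /=; rewrite in_itv/= andbT.
      by rewrite -ltrBlDr ltr_pdivrMr.
    by rewrite -ltrBlDr ltr_pdivrMr.
  rewrite uniform01_gt/=; set r := _ / c.
  have -> : s = e + r * c by rewrite /r divfK ?gt_eqF//; ring.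
  by rewrite !maxEle; repeat case: ifPn; rewrite -?ltNge; nra.
- by rewrite mul0r addr0 subrr.
Qed.

(** The identity [\int_0^1 c phi'(e + u c) du = phi(e + c) - phi(e)] for the ramp
    [phi], whose derivative is an indicator. *)
Lemma uniform_segment a b e c : a <= b ->
  c * fine (U [set u | a < u * c + e <= b]) = ramp a b (e + c) - ramp a b e.
Proof.
move=> ab.
have mS s : measurable [set u : R | s < u * c + e].
  rewrite (_ : [set u | _] = (fun u => u * c + e) @^-1` `]s, +oo[%classic).
    rewrite -[_ @^-1` _]setTI.
    by apply: (measurable_funD (measurable_funM _ _)) => //; exact: measurable_itv.
  by apply/seteqP; split => x /=; rewrite in_itv/= andbT.
have -> : [set u | a < u * c + e <= b] =
    [set u | a < u * c + e] `\` [set u | b < u * c + e].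
  apply/seteqP; split => u /=.
    by move=> /andP[-> H]; split => //; apply/negP; rewrite -leNgt.
  by move=> [-> /negP]; rewrite -leNgt.
have fU s : U [set u : R | s < u * c + e] \is a fin_num.
  by apply: fin_num_measure; exact: mS.
rewrite measureD; [|exact: mS|exact: mS|by move: (fU a); rewrite ge0_fin_numE].
rewrite setIidr; last by move=> u /=; exact: le_lt_trans.
rewrite fineB; [|exact: fU|exact: fU].
by rewrite mulrBr !uniform_halfline /ramp; ring.
Qed.

Lemma measurable_ramp a b : measurable_fun setT (ramp a b).
Proof.
by apply: measurable_funB; apply: measurable_maxr => //; apply: measurable_funB.
Qed.

Lemma ramp_bound a b x : a <= b -> 0 <= ramp a b x <= b - a.
Proof.
by move=> ab; rewrite /ramp !maxEle; repeat case: ifPn; rewrite -?ltNge; lra.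
Qed.

Lemma ramp_norm_le a b x : a <= b -> `|ramp a b x| <= b - a.
Proof. by move=> /(ramp_bound x)/andP[r0 rb]; rewrite ger0_norm. Qed.

Let ramp_incr a b x y : a <= b -> x <= y ->
  0 <= ramp a b y - ramp a b x <= y - x.
Proof.
by move=> ab xy; rewrite /ramp !maxEle; repeat case: ifPn; rewrite -?ltNge; lra.
Qed.

Lemma ramp_pair_bound a b e c : a <= b ->
  0 <= c * (ramp a b (e + c) - ramp a b e) <= c ^+ 2.
Proof.
move=> ab; have [c0|c0] := leP 0 c.
  have /andP[] : 0 <= ramp a b (e + c) - ramp a b e <= e + c - e.
    by apply: ramp_incr => //; lra.
  by nra.
have /andP[] : 0 <= ramp a b e - ramp a b (e + c) <= e - (e + c).
  by apply: ramp_incr => //; lra.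
by nra.
Qed.

(** The form in which [uniform_segment] is used, with the squared difference of a
    pair or the square of the sum as the weight [c ^+ 2]. *)
Lemma integral_uniform_segment a b e c : a <= b ->
  (\int[U]_u ((\1_`]a, b] (u * c + e))%:E * (c ^+ 2)%:E)
   = (c * (ramp a b (e + c) - ramp a b e))%:E)%E.
Proof.
move=> ab.
have maff : measurable_fun setT (fun u : R => u * c + e).
  by apply: (measurable_funD (measurable_funM _ _)).
have mS : measurable [set u : R | a < u * c + e <= b].
  rewrite (_ : [set u | _] = (fun u => u * c + e) @^-1` `]a, b]%classic).
    by rewrite -[_ @^-1` _]setTI; apply: maff => //; exact: measurable_itv.
  by apply/seteqP; split => x /=; rewrite in_itv.
rewrite ge0_integralZr//.
- rewrite -uniform_segment// mulrA -expr2 [RHS]EFinM muleC; congr (_ * _)%E.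
  rewrite fineK; last by apply: fin_num_measure; exact: mS.
  have -> : U [set u | a < u * c + e <= b] =
      (\int[U]_u (\1_[set u | a < u * c + e <= b] u)%:E)%E.
    by rewrite integral_indic// setIT.
  by apply: eq_integral => u _; rewrite !indicE; congr (_%:R)%:E; apply/idP/idP;
    rewrite !inE/= in_itv.
- by apply/measurable_EFinP; apply: measurableT_comp.
- by rewrite lee_fin sqr_ge0.
Qed.

End uniform.

Lemma integral_uniform01 (R : realType) (f : R -> \bar R) :
  (uniform_prob (@ltr01 R)).-integrable setT f ->
  lebesgue_measure.-integrable `[0, 1] f /\
  (\int[uniform_prob (@ltr01 R)]_x f x =
   \int[lebesgue_measure]_(x in `[0%R, 1%R]) f x)%E.
Proof.
have ge0 (g : R -> \bar R) : measurable_fun setT g -> (forall x, 0 <= g x)%E ->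
    (\int[uniform_prob (@ltr01 R)]_x g x =
     \int[lebesgue_measure]_(x in `[0%R, 1%R]) g x)%E.
  by move=> mg g0; rewrite integral_uniform// subr0 invr1 mul1e.
move=> /integrableP[mf foo]; split; last first.
  rewrite [LHS]integralE [RHS]integralE !ge0//.
  - exact: measurable_funeneg.
  - exact: measurable_funepos.
apply/integrableP; split; first exact: measurable_funTS.
by rewrite -ge0//; exact: measurableT_comp.
Qed.

(** * Densities, images and equality in law *)

Section density_measure.
Local Open Scope ereal_scope.
Context d (T : measurableType d) (R : realType) (Q : {measure set T -> \bar R}).
Variable D : T -> \bar R.
Hypotheses (mD : measurable_fun setT D) (D0 : forall x, 0 <= D x).

(** The two proofs are arguments so that the measure structure can be inferred
    from the term. *)
Definition density_measure of measurable_fun setT D & (forall x, 0 <= D x) :=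
  fun A : set T => \int[Q]_(x in A) D x.

Local Notation nu := (density_measure mD D0).

Let nu0 : nu set0 = 0. Proof. by rewrite /nu integral_set0. Qed.

Let nu_ge0 A : 0 <= nu A. Proof. by apply: integral_ge0 => x _; exact: D0. Qed.

Let nu_sigma_additive : semi_sigma_additive nu.
Proof. exact: semi_sigma_additive_nng_induced. Qed.

HB.instance Definition _ := isMeasure.Build _ _ _ nu nu0 nu_ge0 nu_sigma_additive.

Import HBNNSimple.

Let integral_nnsfun_density (h : {nnsfun T >-> R}) :
  \int[nu]_x (h x)%:E = \int[Q]_x ((h x)%:E * D x).
Proof.
under [LHS]eq_integral do rewrite fimfunE -fsumEFin//.
rewrite ge0_integral_fsum//; last 2 first.
- by move=> r; exact/measurable_EFinP/measurableT_comp.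
- by move=> n x _; rewrite EFinM nnfun_muleindic_ge0.
under [RHS]eq_integral => x xE.
  rewrite fimfunE -fsumEFin// ge0_mule_fsuml => [|y]; last exact: nnfun_muleindic_ge0.
  over.
rewrite [RHS]ge0_integral_fsum//; last 2 first.
- move=> y; apply: emeasurable_funM => //.
  by apply/measurable_EFinP; exact: measurable_funM.
- by move=> m y _; rewrite mule_ge0// nnfun_muleindic_ge0.
apply: eq_fsbigr => r rhn.
under [LHS]eq_integral do rewrite EFinM.
rewrite integralZl_indic_nnsfun//.
under [RHS]eq_integral do rewrite EFinM -muleA.
rewrite ge0_integralZl//.
- under [in RHS]eq_integral do rewrite muleC.
  rewrite [in RHS](eq_integral (D \_ (h @^-1` [set r]))); last first.
    by move=> x xE; rewrite epatch_indic.
  by rewrite -integral_mkcond integral_indic// setIT.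
- by apply: emeasurable_funM => //; exact/measurable_EFinP.
- by move=> x _; rewrite mule_ge0.
- by move: rhn; rewrite inE => -[t _ <-]; rewrite lee_fin.
Qed.

Lemma ge0_integral_density_measure (k : T -> \bar R) :
  (forall x, D x \is a fin_num) ->
  measurable_fun setT k -> (forall x, 0 <= k x) ->
  \int[nu]_x k x = \int[Q]_x (k x * D x).
Proof.
move=> Dfin mk k0; pose h := nnsfun_approx measurableT mk.
have hk x : (h n x)%:E @[n --> \oo] --> k x by exact: cvg_nnsfun_approx.
under [LHS]eq_integral => x _ do rewrite -(cvg_lim _ (hk x))//.
under [RHS]eq_integral => x _ do rewrite -(cvg_lim _ (cvgeZr (Dfin x) (hk x)))//.
have ndh x n m : (n <= m)%N -> (h n x <= h m x)%R.
  by move=> nm; exact/lefP/nd_nnsfun_approx.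
rewrite !monotone_convergence//.
- by under eq_fun do rewrite integral_nnsfun_density.
- move=> n; apply: emeasurable_funM => //; exact/measurable_EFinP.
- by move=> n x _; rewrite mule_ge0// lee_fin.
- by move=> x _ n m nm; rewrite lee_wpmul2r// lee_fin ndh.
- by move=> n; exact/measurable_EFinP.
- by move=> n x _; rewrite lee_fin.
- by move=> x _ n m nm; rewrite lee_fin ndh.
Qed.

End density_measure.

Section measure_itv.
Context (R : realType).

Lemma eq_measure_itv_oc (m1 m2 : {measure set (measurableTypeR R) -> \bar R}) :
  (forall a b : R, a <= b -> m1 `]a, b]%classic = m2 `]a, b]%classic) ->
  (forall a b : R, m1 `]a, b]%classic < +oo)%E ->
  forall A, measurable A -> m1 A = m2 A.
Proof.
move=> m12 m1oo A mA.
apply: (@measure_unique _ _ (measurableTypeR R) (@ocitv R)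
  (fun n => `](- n%:R), n%:R]%classic)) => //.
- exact: (@measurableI _ (ocitv_type R)).
- by move=> n; exact: is_ocitv.
- exact: bigcup_itvT.
- move=> B /ocitvP[->|[[a b] /= ab ->]]; first by rewrite !measure0.
  by apply: m12; exact: ltW.
Qed.
End measure_itv.

(** [pushforward] bundled with the measurability of the map, which the measure
    structure depends on but the raw set function does not mention. *)
Definition image_measure (R : realType) d d' (T : measurableType d)
    (T' : measurableType d') (m : {measure set T -> \bar R}) (f : T -> T')
    (mf : measurable_fun setT f) : {measure set T' -> \bar R}.
Proof. by refine (pushforward m f); exact: mf. Defined.

Lemma measurable_preimage_itv d (T : measurableType d) (R : realType) (f : T -> R)
    (i : interval R) : measurable_fun setT f -> measurable (f @^-1` [set` i]).
Proof.
by move=> mf; rewrite -[_ @^-1` _]setTI; apply: mf => //; exact: measurable_itv.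
Qed.

Lemma expectationE d (T : measurableType d) (R : realType) (P : probability T R)
  (V : T -> R) : ('E_P[V] = \int[P]_w (V w)%:E)%E.
Proof. by rewrite unlock. Qed.

Section finite_partition.
Local Open Scope ereal_scope.
Context (R : realType) d (T : measurableType d) (P : probability T R) (n : nat).

Lemma measure_sum_fibers (I : T -> 'I_n) (E : set T) :
  (forall i, measurable (I @^-1` [set i])) -> measurable E ->
  P E = \sum_(i < n) P (I @^-1` [set i] `&` E).
Proof.
move=> mI mE; rewrite -measure_bigsetU_ord//.
- congr (P _); rewrite -bigcup_seq; apply/seteqP; split => w /=.
    by move=> Ew; exists (I w) => //=; rewrite mem_index_enum.
  by move=> [i _ []].
- by move=> i; exact: measurableI.
- by apply/trivIsetP => i j _ _ ij; apply/seteqP; split => // w [[/= -> _] [/= e _]];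
    rewrite e eqxx in ij.
Qed.

End finite_partition.

Section same_law.
Local Open Scope ereal_scope.
Context (R : realType) d1 d2 d (T1 : measurableType d1) (T2 : measurableType d2)
  (S : measurableType d) (P : probability T1 R) (Q : probability T2 R)
  (X : T1 -> S) (Y : T2 -> S).
Hypotheses (mX : measurable_fun setT X) (mY : measurable_fun setT Y).
Hypothesis XY : same_law P Q X Y.

Let ge0_same_law_integral (g : S -> \bar R) : measurable_fun setT g ->
  (forall s, 0 <= g s) -> \int[P]_w g (X w) = \int[Q]_w g (Y w).
Proof.
move=> mg g0; transitivity (\int[image_measure P mX]_s g s).
  by rewrite ge0_integral_pushforward.
rewrite (eq_measure_integral (image_measure Q mY)).
  by rewrite ge0_integral_pushforward.
by move=> A mA _; exact: XY.
Qed.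

Lemma same_law_integral (g : S -> \bar R) : measurable_fun setT g ->
  \int[P]_w g (X w) = \int[Q]_w g (Y w).
Proof.
move=> mg; rewrite [LHS]integralE [RHS]integralE; congr (_ - _).
  under eq_integral do rewrite funeposE.
  under [RHS]eq_integral do rewrite funeposE.
  apply: (@ge0_same_law_integral (fun s => maxe (g s) 0)).
    by apply: measurable_maxe.
  by move=> s; rewrite le_max lexx orbT.
under eq_integral do rewrite funenegE.
under [RHS]eq_integral do rewrite funenegE.
apply: (@ge0_same_law_integral (fun s => maxe (- g s) 0)).
  by apply: measurable_maxe => //; exact: measurableT_comp.
by move=> s; rewrite le_max lexx orbT.
Qed.

Lemma same_law_integrable (g : S -> \bar R) : measurable_fun setT g ->
  P.-integrable setT (g \o X) -> Q.-integrable setT (g \o Y).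
Proof.
move=> mg /integrableP[_ gX]; apply/integrableP; split.
  exact: measurableT_comp.
by rewrite -(@ge0_same_law_integral (fun s => `|g s|))//; exact: measurableT_comp.
Qed.

End same_law.

Lemma integrableM_bounded (R : realType) d (T : measurableType d)
    (P : probability T R) (V B : T -> R) (M : R) :
  P.-integrable setT (EFin \o V) -> measurable_fun setT B ->
  (forall w, `|B w| <= M) -> P.-integrable setT (EFin \o (fun w => V w * B w)).
Proof.
move=> iV mB BM; have mV := measurable_int _ iV.
apply: (@le_integrable _ _ _ _ _ _ _ (EFin \o (fun w => M * V w))) => //.
- by apply/measurable_EFinP; apply: measurable_funM => //; exact/measurable_EFinP.
- move=> w _ /=; rewrite lee_fin !normrM mulrC ler_wpM2r//.
  by rewrite (le_trans (BM w))// ler_norm.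
- by have := integrableZl measurableT M iV; under eq_fun do rewrite /= -EFinM.
Qed.

(** * Zero biasing tested on intervals *)

Section zero_bias_criterion.
Context (R : realType) d d' (T : measurableType d) (T' : measurableType d')
  (P : probability T R) (P' : probability T' R) (W : T -> R) (Ws : T' -> R).
Hypotheses (mW : measurable_fun setT W) (mWs : measurable_fun setT Ws).
Hypothesis iW : P.-integrable setT (EFin \o W).
Hypothesis EW0 : (\int[P]_w (W w)%:E = 0)%E.
Hypothesis iW2 : P.-integrable setT (EFin \o (fun w => W w ^+ 2)).

Local Notation U := (uniform_prob (@ltr01 R)).

Let Z (z : T * measurableTypeR R) : measurableTypeR R := (z.2 : R) * W z.1.
Let D (z : T * measurableTypeR R) : \bar R := (W z.1 ^+ 2)%:E.

Let mZ : measurable_fun setT Z.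
Proof.
apply: measurable_funM; first exact: measurable_snd.
by apply: (measurableT_comp mW); exact: measurable_fst.
Qed.

Let mD : measurable_fun setT D.
Proof.
apply/measurable_EFinP; apply: measurable_funX.
by apply: (measurableT_comp mW); exact: measurable_fst.
Qed.

Let D0 z : (0 <= D z)%E. Proof. by rewrite lee_fin sqr_ge0. Qed.

Let nu : {measure set (T * measurableTypeR R) -> \bar R} :=
  density_measure (P \x U)%E mD D0.

(** Up to the factor [E W ^+ 2], the law of [u W'] with [u] uniform and [W'] an
    independent square-biased version of [W]: a classical description of the
    zero biased distribution. *)
Let m2 : {measure set (measurableTypeR R) -> \bar R} := image_measure nu mZ.

Let iWramp a b : a <= b ->
  P.-integrable setT (EFin \o (fun w => W w * ramp a b (W w))).
Proof.
move=> ab; apply: (integrableM_bounded iW) => [|w]; last exact: ramp_norm_le.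
exact: (measurableT_comp (measurable_ramp a b)).
Qed.

(** Since [W] has mean zero, [W phi(W)] may be replaced by [W (phi(W) - phi(0))],
    which is the integral of [W ^+ 2 phi'(u W)] over [u]. *)
Let m2_itv a b : a <= b ->
  m2 `]a, b]%classic = (\int[P]_w (W w * ramp a b (W w))%:E)%E.
Proof.
move=> ab.
have mitv : measurable (`]a, b]%classic : set R) by exact: measurable_itv.
rewrite /m2/= /pushforward/= /nu/= /density_measure.
rewrite (_ : (\int[_]_(x in _) D x)%E =
   (\int[P \x U]_z ((\1_`]a, b] (Z z))%:E * D z))%E); last first.
  rewrite integral_mkcond; apply: eq_integral => z _; rewrite patchE indicE.
  rewrite (_ : (z \in _) = (Z z \in `]a, b]%classic)).
    by case: ifP => _; rewrite ?mul1e ?mul0e.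
  by apply/idP/idP; rewrite !inE.
rewrite fubini_tonelli1/=; last 2 first.
- apply: emeasurable_funM => //; apply/measurable_EFinP.
  by apply: (measurableT_comp (measurable_indic _)).
- by move=> z; rewrite mule_ge0// lee_fin.
transitivity (\int[P]_w (W w * ramp a b (W w) - ramp a b 0 * W w)%:E)%E.
  apply: eq_integral => w _; rewrite /fubini_F /Z /D/=.
  have := integral_uniform_segment 0 (W w) ab.
  under eq_integral do rewrite addr0.
  by move=> ->; rewrite add0r mulrBr (mulrC (W w) (ramp a b 0)).
have iW' : P.-integrable setT (fun w => (ramp a b 0 * W w)%:E).
  have := integrableZl measurableT (ramp a b 0) iW.
  by under eq_fun do rewrite /= -EFinM.
rewrite integralB_EFin//; last exact: iWramp.
rewrite (_ : \int[P]_w (ramp a b 0 * W w)%:E = 0)%E ?sube0//.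
under eq_integral do rewrite EFinM.
by rewrite integralZl// EW0 mule0.
Qed.

Let sigma2 : R := fine (\int[P]_w (W w ^+ 2)%:E)%E.

Let sigma2E : (sigma2%:E = \int[P]_w (W w ^+ 2)%:E)%E.
Proof. by rewrite fineK//; exact: integrable_fin_num. Qed.

Let m2T : m2 setT = sigma2%:E.
Proof.
rewrite /m2/= /pushforward/= preimage_setT /nu/= /density_measure.
rewrite fubini_tonelli1// sigma2E; apply: eq_integral => w _.
by rewrite /fubini_F /D/= integral_cst//= probability_setT mule1.
Qed.

Let m1 : {measure set (measurableTypeR R) -> \bar R} :=
  image_measure P' (mWs : measurable_fun setT (Ws : T' -> measurableTypeR R)).

Let cvg_itv (m : {measure set (measurableTypeR R) -> \bar R}) :
  m `](- n%:R), n%:R]%classic @[n --> \oo] --> m setT.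
Proof.
have mI n : measurable (`](- n%:R), n%:R]%classic : set (measurableTypeR R)).
  exact: measurable_itv.
have := @nondecreasing_cvg_mu _ _ _ m (fun n => `](- n%:R), n%:R]%classic) mI.
rewrite bigcup_itvT; apply; first exact: measurableT.
move=> n n' nn'; apply/subsetPset; apply: subset_itv; rewrite bnd_simp ?lerN2 ler_nat//.
Qed.

Section law.
Variables (S kappa : R).
Hypothesis S0 : 0 < S.
Hypothesis lawE : forall a b, a <= b ->
  (S%:E * P' (Ws @^-1` `]a, b]) = kappa%:E * \int[P]_w (W w * ramp a b (W w))%:E)%E.

Let m1T : m1 setT = 1%E.
Proof. by rewrite /m1/= /pushforward preimage_setT probability_setT. Qed.

(** Both sides of [lawE] are multiples of measures; exhausting the line by
    intervals compares their total masses. *)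
Let kappaE : kappa * sigma2 = S.
Proof.
pose I (n : nat) : set (measurableTypeR R) := `](- n%:R), n%:R]%classic.
have c1 : (S%:E * m1 (I n))%E @[n --> \oo] --> (S%:E * m1 setT)%E.
  by apply: cvgeZl => //; exact: cvg_itv.
have c2 : (S%:E * m1 (I n))%E @[n --> \oo] --> (kappa%:E * m2 setT)%E.
  rewrite (_ : (fun n : nat => _) =
      (fun n : nat => kappa%:E * m2 (I n))%E).
    by apply: cvgeZl => //; exact: cvg_itv.
  apply/funext => n; have nn : - (n%:R : R) <= n%:R by rewrite ge0_cp// ler0n.
  by rewrite m2_itv//; exact: lawE.
suff : (kappa * sigma2)%:E = S%:E by case.
rewrite EFinM -m2T.
by have := cvg_unique (@ereal_hausdorff R) c1 c2; rewrite m1T mule1 => ->.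
Qed.

Let sigma20 : 0 <= sigma2.
Proof. by apply: fine_ge0; apply: integral_ge0 => w _; rewrite lee_fin sqr_ge0. Qed.

Let m1m2 A : measurable A -> (sigma2%:E * m1 A)%E = m2 A.
Proof.
move=> mA; pose m1' : {measure set (measurableTypeR R) -> \bar R} :=
  mscale (NngNum sigma20) m1.
rewrite -[LHS]/(m1' A); apply: eq_measure_itv_oc mA => a b.
- move=> ab; rewrite m2_itv//= /mscale/=.
  have k0 : kappa != 0 by apply: contraTneq S0 => k0; rewrite -kappaE k0 mul0r ltxx.
  have : (S%:E * m1 `]a, b]%classic = kappa%:E * \int[P]_w (W w * ramp a b (W w))%:E)%E.
    exact: lawE.
  rewrite -kappaE EFinM -muleA => /(congr1 (mule (kappa^-1)%:E)).
  by rewrite !muleA -!EFinM mulVf// mul1r mul1e.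
- have : (m1 `]a, b]%classic <= 1)%E.
    rewrite -m1T; apply: le_measure => //; rewrite inE; last exact: measurableT.
    exact: measurable_itv.
  rewrite /m1'/= /mscale/= => m11.
  apply: (@le_lt_trans _ _ (sigma2%:E * 1)%E); last by rewrite mule1 ltry.
  exact: lee_wpmul2l.
Qed.

Lemma ge0_integral_zero_bias (k : R -> \bar R) : measurable_fun setT k ->
  (forall x, 0 <= k x)%E ->
  (sigma2%:E * \int[P']_w k (Ws w) =
   \int[P \x U]_z (k (z.2 * W z.1)%R * (W z.1 ^+ 2)%:E))%E.
Proof.
move=> mk k0.
transitivity (\int[m2]_x k x)%E.
  pose m1' : {measure set (measurableTypeR R) -> \bar R} :=
    mscale (NngNum sigma20) m1.
  transitivity (\int[m1']_x k x)%E.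
    by rewrite ge0_integral_mscale//; congr (_ * _)%E; rewrite ge0_integral_pushforward.
  by apply: eq_measure_integral => A mA _; rewrite -m1m2.
rewrite ge0_integral_pushforward//= ge0_integral_density_measure//.
by apply: (measurableT_comp mk).
Qed.

Let integral_zero_bias (g : R -> R) : measurable_fun setT g ->
  P'.-integrable setT (EFin \o (g \o Ws)) ->
  (P \x U)%E.-integrable setT (fun z => (g (z.2 * W z.1)%R * W z.1 ^+ 2)%:E) /\
  (sigma2%:E * \int[P']_w (g (Ws w))%:E =
   \int[P \x U]_z (g (z.2 * W z.1)%R * W z.1 ^+ 2)%:E)%E.
Proof.
move=> mg ig; pose G z := (g (z.2 * W z.1) * W z.1 ^+ 2)%:E.
have mG : measurable_fun setT G.
  apply/measurable_EFinP; apply: measurable_funM.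
    exact: (measurableT_comp mg mZ).
  by apply/measurable_EFinP; exact: mD.
have mgE : measurable_fun setT (EFin \o g) by exact/measurable_EFinP.
have absG : (sigma2%:E * \int[P']_w `|(g (Ws w))%:E| = \int[P \x U]_z `|G z|)%E.
  rewrite (@ge0_integral_zero_bias (fun x => `|(g x)%:E|)%E)//; last first.
    exact: measurableT_comp.
  apply: eq_integral => z _; rewrite /G [in RHS]EFinM abseM; congr (_ * _)%E.
  by rewrite gee0_abs// lee_fin sqr_ge0.
split.
  apply/integrableP; split; first exact: mG.
  rewrite -absG; apply: lte_mul_pinfty; rewrite ?lee_fin//.
  by have /integrableP[] := ig.
rewrite [RHS]integralE.
have -> : (\int[P \x U]_z G^\+ z = sigma2%:E * \int[P']_w (EFin \o g)^\+ (Ws w))%E.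
  rewrite ge0_integral_zero_bias//; last exact: measurable_funepos.
  apply: eq_integral => z _; rewrite !funeposE /G/=.
  by rewrite -[in RHS]EFin_max -EFinM maxr_pMl ?sqr_ge0// mul0r EFin_max.
have -> : (\int[P \x U]_z G^\- z = sigma2%:E * \int[P']_w (EFin \o g)^\- (Ws w))%E.
  rewrite ge0_integral_zero_bias//; last exact: measurable_funeneg.
  apply: eq_integral => z _; rewrite !funenegE /G/=.
  by rewrite -[in RHS]EFin_max -[in RHS]EFinM maxr_pMl ?sqr_ge0// mul0r mulNr EFin_max.
rewrite integralE muleBr//.
  congr (_ * _ - _ * _)%E; apply: eq_integral => w _.
    by rewrite !funeposE.
  by rewrite !funenegE.
by apply: fin_num_adde_defr; exact: integrable_pos_fin_num.
Qed.

(** It is enough to test the law of [Ws] on intervals, and only up to constants.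
    For a general [f], [W f(W)] alone is integrable, and [f'] need not be locally
    integrable, so the integration by parts is done along the fibres: Fubini's
    theorem makes [u |-> W ^+ 2 f'(u W)] integrable for almost every value of [W],
    and [integral_derive1] identifies its integral with [W (f(W) - f(0))]. *)
Lemma zero_biased_of_itv : zero_biased P P' W Ws.
Proof.
split=> // f df iWf ifWs.
have vW : ('V_P[W] = sigma2%:E)%E.
  rewrite /variance unlock /= unlock.
  rewrite EW0 sigma2E; apply: eq_integral => w _ /=.
  by rewrite -[LHS]/((W w - 0) * (W w - 0))%:E subr0 expr2.
have [iG] := integral_zero_bias (measurable_derive1 df) ifWs.
rewrite vW unlock => ->.
rewrite -integral12_prod_meas1//.
have iWf0 : P.-integrable setT (EFin \o (fun w => f 0 * W w)).
  by have := integrableZl measurableT (f 0) iW; under eq_fun do rewrite /= -EFinM.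
transitivity (\int[P]_w (W w * f (W w) - f 0 * W w)%:E)%E.
  rewrite integralB_EFin//.
  rewrite (_ : \int[P]_w (f 0 * W w)%:E = 0)%E ?sube0//.
  by under eq_integral do rewrite EFinM; rewrite integralZl// EW0 mule0.
apply: ae_eq_integral => //.
- have /measurable_int m1Wf := iWf; have /measurable_int m2Wf := iWf0.
  by apply/measurable_EFinP; apply: measurable_funB; exact/measurable_EFinP.
- exact: (measurable_fubini_F iG).
have := ae_integrable1 iG.
apply: filterS => w /= iw _.
have [iw01 E01] := integral_uniform01 iw; rewrite /fubini_F/= E01.
pose h (u : R) := W w * f (u * W w).
have hE (u : R) : is_derive u 1 h (derive1 f (u * W w) * W w ^+ 2).
  have dfu : is_derive (u * W w) 1 f (derive1 f (u * W w)).
    by rewrite derive1E; split.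
  have dlin : is_derive u 1 (fun u : R => u * W w) (W w).
    by apply: is_derive_eq; rewrite /GRing.scale/=; ring.
  have dcomp := @is_derive1_comp _ f (fun u => u * W w) u _ _ dfu dlin.
  by apply: is_derive_eq; rewrite /GRing.scale/=; ring.
have h'E : derive1 h = fun u => derive1 f (u * W w) * W w ^+ 2.
  by apply/funext => u; rewrite derive1E derive_val.
have dh u : derivable h u 1 by have [] := hE u.
have := @integral_derive1 _ h 0 1 ltr01 dh.
rewrite h'E => /(_ iw01) E.
rewrite -[RHS]fineK; last first.
  by apply: integrable_fin_num; [exact: measurable_itv|exact: iw01].
by rewrite -/(Rintegral _ _ _) E /h mul1r mul0r (mulrC (f 0)).
Qed.

End law.
End zero_bias_criterion.

(** * Exchangeable pairs inside a collection *)

Section collection.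
Context (R : realType) (n : nat).
Implicit Types (i j : 'I_n) (t : n.+1.-tuple R).

Lemma lift_pos2 i : lift (pos2 i) i = pos1 i.
Proof. by apply: val_inj; rewrite /= /bump /= ltnn. Qed.

Lemma x1_drop2 i t : x1 i t = tnth (drop2 i t) i.
Proof. by rewrite tnth_mktuple lift_pos2. Qed.

Lemma sum_drop2 i t : \sum_(j < n) tnth (drop2 i t) j = rest i t + x1 i t.
Proof. by rewrite (bigD1 i)//= addrC -x1_drop2. Qed.

Lemma x1_swap i t : x1 i (swap i t) = x2 i t.
Proof. by rewrite /x1 tnth_mktuple tpermL. Qed.

Lemma x2_swap i t : x2 i (swap i t) = x1 i t.
Proof. by rewrite /x2 tnth_mktuple tpermR. Qed.

Lemma rest_swap i t : rest i (swap i t) = rest i t.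
Proof.
apply: eq_bigr => j ji; rewrite !tnth_mktuple tpermD//; last exact: neq_lift.
by rewrite -lift_pos2; apply: contra_neq ji => /lift_inj.
Qed.

Lemma mixE i (u : R) t : mix i u t = u * (x1 i t - x2 i t) + (rest i t + x2 i t).
Proof. by rewrite /mix; ring. Qed.

Lemma measurable_x1 i : measurable_fun setT (@x1 R n i).
Proof. exact: measurable_tnth. Qed.

Lemma measurable_x2 i : measurable_fun setT (@x2 R n i).
Proof. exact: measurable_tnth. Qed.

Lemma measurable_rest i : measurable_fun setT (@rest R n i).
Proof.
rewrite (_ : @rest R n i = fun t =>
    \sum_(j <- [seq j <- index_enum _ | j != i]) tnth (drop2 i t) j); last first.
  by apply/funext => t; rewrite big_filter.
apply: measurable_sum => j; under eq_fun do rewrite tnth_mktuple.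
exact: measurable_tnth.
Qed.

Lemma measurable_drop2 i : measurable_fun setT (@drop2 R n i).
Proof.
apply/measurable_fun_tnthP => j.
rewrite (_ : _ \o _ = fun t => tnth t (lift (pos2 i) j)).
  exact: measurable_tnth.
by apply/funext => t; exact: tnth_mktuple.
Qed.

Lemma measurable_swap i : measurable_fun setT (@swap R n i).
Proof.
apply/measurable_fun_tnthP => j.
rewrite (_ : _ \o _ = fun t => tnth t (tperm (pos1 i) (pos2 i) j)).
  exact: measurable_tnth.
by apply/funext => t; exact: tnth_mktuple.
Qed.

End collection.

Section moments.
Context (R : realType) (n : nat) (F : probability (n.+1.-tuple R) R) (i : 'I_n).
Hypothesis swapF : same_law F F id (swap i).
Hypothesis ix1 : F.-integrable setT (EFin \o x1 i).
Variables (phi : R -> R) (M : R).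
Hypotheses (mphi : measurable_fun setT phi) (phiM : forall x, `|phi x| <= M).

Let phi1 (t : n.+1.-tuple R) := phi (rest i t + x1 i t).
Let phi2 (t : n.+1.-tuple R) := phi (rest i t + x2 i t).

Let mphi1 : measurable_fun setT phi1.
Proof.
apply: (measurableT_comp mphi); apply: measurable_funD.
  exact: measurable_rest.
exact: measurable_x1.
Qed.

Let mphi2 : measurable_fun setT phi2.
Proof.
apply: (measurableT_comp mphi); apply: measurable_funD.
  exact: measurable_rest.
exact: measurable_x2.
Qed.

Lemma integrable_x1_phi1 :
  F.-integrable setT (EFin \o (fun t => x1 i t * phi (rest i t + x1 i t))).
Proof. by apply: (integrableM_bounded ix1 mphi1 (M := M)) => w; exact: phiM. Qed.

Lemma integrable_x1_phi2 :
  F.-integrable setT (EFin \o (fun t => x1 i t * phi (rest i t + x2 i t))).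
Proof. by apply: (integrableM_bounded ix1 mphi2 (M := M)) => w; exact: phiM. Qed.

(** Expanding the product gives four terms, equal in pairs because the swap
    exchanges [x1] and [x2] and fixes [rest]. *)
Lemma integral_exchangeable_pair :
  (\int[F]_t ((x1 i t - x2 i t) *
     (phi (rest i t + x1 i t) - phi (rest i t + x2 i t)))%:E
   = 2%:E * (\int[F]_t (x1 i t * phi (rest i t + x1 i t))%:E
             - \int[F]_t (x1 i t * phi (rest i t + x2 i t))%:E))%E.
Proof.
pose g t := x1 i t * (phi1 t - phi2 t).
have mg : measurable_fun setT (EFin \o g).
  apply/measurable_EFinP; apply: measurable_funM; first exact: measurable_x1.
  exact: measurable_funB.
have gE : g = fun t => x1 i t * phi1 t - x1 i t * phi2 t.
  by apply/funext => t; rewrite /g mulrBr.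
have ig : F.-integrable setT (EFin \o g).
  rewrite gE.
  have := integrableB measurableT integrable_x1_phi1 integrable_x1_phi2.
  by under eq_fun do rewrite /= -EFinB.
have ig' : F.-integrable setT (EFin \o (g \o swap i)).
  exact: (same_law_integrable (@measurable_id _ _ _) (measurable_swap i) swapF mg).
transitivity (\int[F]_t (g t + g (swap i t))%:E)%E.
  apply: eq_integral => t _; congr EFin.
  by rewrite /g /phi1 /phi2 x1_swap x2_swap rest_swap; ring.
rewrite integralD_EFin//.
have <- := same_law_integral (@measurable_id _ _ _) (measurable_swap i) swapF mg.
rewrite /= gE integralB_EFin//; [|exact: integrable_x1_phi1|exact: integrable_x1_phi2].
by rewrite -[LHS]mule2n mule_natl.
Qed.

End moments.

(** * The law of the mixture along a random segment *)

Section mixture.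
Context (R : realType) (n : nat) (F : probability (n.+1.-tuple R) R) (i : 'I_n).
Hypothesis iv : F.-integrable setT (EFin \o (fun t => (x1 i t - x2 i t) ^+ 2)).
Local Notation U := (uniform_prob (@ltr01 R)).
Local Notation v := (vsq F i).

Let mx12 : measurable_fun setT (fun t : n.+1.-tuple R => x1 i t - x2 i t).
Proof. by apply: measurable_funB; [exact: measurable_x1|exact: measurable_x2]. Qed.

Let mmix : measurable_fun setT
  (fun z : measurableTypeR R * n.+1.-tuple R => mix i (z.1 : R) z.2 : R).
Proof.
under eq_fun do rewrite mixE.
apply: measurable_funD; first apply: measurable_funM.
- exact: measurable_fst.
- by apply: (measurableT_comp mx12); exact: measurable_snd.
- apply: measurable_funD; apply: measurableT_comp (measurable_snd) => //.
    exact: measurable_rest.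
  exact: measurable_x2.
Qed.

Lemma measurable_mix_comp d (T : measurableType d) (V : T -> R)
    (X : T -> n.+1.-tuple R) :
  measurable_fun setT V -> measurable_fun setT X ->
  measurable_fun setT (fun w => mix i (V w) (X w)).
Proof.
move=> mV mX; apply: (measurableT_comp mmix (g := fun w => (V w, X w))).
exact: measurable_fun_pair.
Qed.

Lemma vsqE : (v%:E = \int[F]_t ((x1 i t - x2 i t) ^+ 2)%:E)%E.
Proof. by rewrite /vsq unlock fineK//; exact: integrable_fin_num. Qed.

Lemma vsq_ge0 : 0 <= v.
Proof.
by rewrite -lee_fin vsqE; apply: integral_ge0 => t _; rewrite lee_fin sqr_ge0.
Qed.

Let integral_mix a b t : a <= b ->
  (\int[U]_u ((\1_`]a, b] (mix i u t))%:E * ((x1 i t - x2 i t) ^+ 2 / v)%:E)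
   = (v^-1 * ((x1 i t - x2 i t) *
       (ramp a b (rest i t + x1 i t) - ramp a b (rest i t + x2 i t))))%:E)%E.
Proof.
move=> ab.
have := integral_uniform_segment (rest i t + x2 i t) (x1 i t - x2 i t) ab.
rewrite [_ + _ + (_ - _)](_ : _ = rest i t + x1 i t); last by ring.
move=> /(congr1 (fun x => (v^-1)%:E * x)%E); rewrite -[RHS]EFinM => <-.
rewrite -ge0_integralZl//.
- apply: eq_integral => u _; rewrite mixE [RHS]muleCA; congr (_ * _)%E.
  by rewrite -[RHS]EFinM mulrC.
- apply: emeasurable_funM => //; apply/measurable_EFinP.
  apply: (measurableT_comp (measurable_indic _)) => //.
  by apply: measurable_funD => //; exact: measurable_funM.
- by move=> u _; rewrite -EFinM lee_fin mulr_ge0// sqr_ge0.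
- by rewrite lee_fin invr_ge0 vsq_ge0.
Qed.

Lemma ramp_pair_bound_tuple a b (t : n.+1.-tuple R) : a <= b ->
  0 <= (x1 i t - x2 i t) *
    (ramp a b (rest i t + x1 i t) - ramp a b (rest i t + x2 i t)) <=
  (x1 i t - x2 i t) ^+ 2.
Proof.
move=> ab; have := ramp_pair_bound (rest i t + x2 i t) (x1 i t - x2 i t) ab.
by rewrite [_ + _ + (_ - _)](_ : _ = rest i t + x1 i t); last by ring.
Qed.

Lemma measurable_ramp_pair a b : measurable_fun setT
  (fun t : n.+1.-tuple R => ((x1 i t - x2 i t) *
     (ramp a b (rest i t + x1 i t) - ramp a b (rest i t + x2 i t)))%:E).
Proof.
apply/measurable_EFinP; apply: measurable_funM => //.
apply: measurable_funB; apply: (measurableT_comp (measurable_ramp a b));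
  (apply: measurable_funD; first exact: measurable_rest).
- exact: measurable_x1.
- exact: measurable_x2.
Qed.

Context d (T : measurableType d) (P : probability T R) (J : set T) (p : R)
  (V : {RV P >-> R}) (X : {RV P >-> n.+1.-tuple R}).
Hypotheses (mJ : measurable J) (v0 : 0 < v).
Hypothesis lawX : forall C, measurable C -> pushforward P X C = hat_law F i C.
Hypothesis indep : forall A C, measurable A -> measurable C ->
  P (J `&` (V @^-1` A `&` X @^-1` C)) = (p%:E * (U A * P (X @^-1` C)))%E.

Let mVX : measurable_fun setT (fun w => (V w, X w) : measurableTypeR R * n.+1.-tuple R).
Proof.
by apply: measurable_fun_pair; [exact: (measurable_funPT V)|exact: measurable_funPT].
Qed.

(** Why the weight [(x1 - x2) ^+ 2] is the right one: given the collection, the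
    point moves uniformly along the segment from [rest + x2] to [rest + x1], and
    averaging the derivative of a ramp along a segment yields the difference of
    its end values divided by the length [x1 - x2]; one factor of the weight
    cancels the division and the other remains. The event [J] carries the value of
    the random index. *)
Lemma law_mix a b : a <= b ->
  P (J `&` [set w | mix i (V w) (X w) \in `]a, b]]) =
  (p%:E * ((v^-1)%:E * \int[F]_t ((x1 i t - x2 i t) *
     (ramp a b (rest i t + x1 i t) - ramp a b (rest i t + x2 i t)))%:E))%E.
Proof.
move=> ab.
have p0 : 0 <= p.
  have := indep measurableT measurableT.
  rewrite !preimage_setT !setIT !probability_setT !mule1 -lee_fin => <-.
  exact: measure_ge0.
pose B : set (measurableTypeR R * n.+1.-tuple R) :=
  [set z | mix i (z.1 : R) z.2 \in `]a, b]].
have mB : measurable B.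
  by rewrite -[B]setTI; exact: (mmix measurableT (measurable_itv `]a, b])).
have BE z : (z \in B) = (mix i (z.1 : R) z.2 \in `]a, b]%classic).
  by apply/idP/idP; rewrite !inE.
pose m' : {measure set (measurableTypeR R * n.+1.-tuple R) -> \bar R} :=
  image_measure (mrestr P mJ) mVX.
have m'E : m' B = (p%:E * (U \x distribution P X) B)%E.
  have [p00|pn0] := eqVneq p 0.
    rewrite p00 mul0e; apply: subset_measure0 measurableT _ _ => //.
    rewrite /m'/= /pushforward preimage_setT /mrestr setTI.
    have := indep measurableT measurableT.
    by rewrite !preimage_setT !setIT p00 mul0e.
  have ip0 : 0 <= p^-1 by rewrite invr_ge0.
  rewrite (@product_measure_unique _ _ _ _ _ _ _ (mscale (NngNum ip0) m'))//.
    by rewrite /mscale/= muleA -EFinM mulfV// mul1e.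
  move=> A C mA mC; transitivity ((p^-1)%:E * P (J `&` (V @^-1` A `&` X @^-1` C)))%E.
    by rewrite setIC.
  by rewrite indep// muleA -EFinM mulVf// mul1e.
transitivity (m' B).
  by rewrite /m'/= /pushforward /mrestr setIC.
rewrite m'E; congr (_ * _)%E.
(* integrating first over [u] means that only values [hat_law] of measurable sets
   are needed, never integrals against it *)
transitivity (\int[U]_u \int[F]_t
    ((\1_`]a, b] (mix i u t))%:E * ((x1 i t - x2 i t) ^+ 2 / v)%:E))%E.
  apply: eq_integral => u _.
  rewrite -[LHS]/(pushforward P X (xsection B u)) lawX; last exact: measurable_xsection.
  rewrite /hat_law integral_mkcond; apply: eq_integral => t _.
  rewrite patchE indicE -(BE (u, t)) mem_xsection.
  by case: ifP => _; rewrite ?mul1e ?mul0e.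
have mf : measurable_fun setT (fun z : measurableTypeR R * n.+1.-tuple R =>
   ((\1_`]a, b] (mix i (z.1 : R) z.2))%:E * ((x1 i z.2 - x2 i z.2) ^+ 2 / v)%:E)%E).
  apply: emeasurable_funM; apply/measurable_EFinP.
    exact: (measurableT_comp (measurable_indic (measurable_itv _)) mmix).
  apply: measurable_funM => //; apply: measurable_funX.
  by apply: (measurableT_comp mx12); exact: measurable_snd.
rewrite (fubini_tonelli _ mf)/=; last first.
  by move=> z; rewrite -EFinM lee_fin mulr_ge0// divr_ge0 ?sqr_ge0// ltW.
under eq_integral do rewrite integral_mix//.
under eq_integral do rewrite EFinM.
rewrite ge0_integralZl//.
- exact: measurable_ramp_pair.
- by move=> t _; have /andP[] := ramp_pair_bound_tuple t ab; rewrite lee_fin.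
- by rewrite lee_fin invr_ge0 ltW.
Qed.
End mixture.

(** * Conditional expectation and bounded functions *)

Section conditional_expectation.
Context (R : realType) d (T : measurableType d) (P : probability T R)
  (X Z : T -> R) (h : R -> R).
Hypotheses (mZ : measurable_fun setT Z) (XZ : is_cond_expectation P X Z h).

Let Y w := X w - h (Z w).

Let iY : P.-integrable setT (EFin \o Y).
Proof.
case: XZ => _ iX ih _.
by have := integrableB measurableT iX ih; under eq_fun do rewrite /= -EFinB.
Qed.

Let mY : measurable_fun setT Y.
Proof. by apply/measurable_EFinP; exact: measurable_int iY. Qed.

Let Yp w := Num.max (Y w) 0.
Let Yn w := Num.max (- Y w) 0.

Let mYp : measurable_fun setT (EFin \o Yp).
Proof. by apply/measurable_EFinP; apply: measurable_maxr. Qed.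

Let mYn : measurable_fun setT (EFin \o Yn).
Proof.
by apply/measurable_EFinP; apply: measurable_maxr => //; exact: measurableT_comp.
Qed.

Let Yp0 w : (0 <= (EFin \o Yp) w)%E.
Proof. by rewrite lee_fin le_max lexx orbT. Qed.

Let Yn0 w : (0 <= (EFin \o Yn) w)%E.
Proof. by rewrite lee_fin le_max lexx orbT. Qed.

Let YpE : EFin \o Yp = ((EFin \o Y)^\+)%E.
Proof. by apply/funext => w; rewrite funeposE /= EFin_max. Qed.

Let YnE : EFin \o Yn = ((EFin \o Y)^\-)%E.
Proof. by apply/funext => w; rewrite funenegE /= EFin_max. Qed.

Let eq_parts (B : set R) : measurable B ->
  (\int[P]_(w in Z @^-1` B) (Yp w)%:E = \int[P]_(w in Z @^-1` B) (Yn w)%:E)%E.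
Proof.
move=> mB; have mZB : measurable (Z @^-1` B) by rewrite -[_ @^-1` _]setTI; exact: mZ.
case: XZ => _ iX ih /(_ B mB) XhB.
have iYB : P.-integrable (Z @^-1` B) (EFin \o Y) by exact: integrableS iY.
have : (\int[P]_(w in Z @^-1` B) (Y w)%:E = 0)%E.
  rewrite integralB_EFin//; [|exact: integrableS iX|exact: integrableS ih].
  rewrite XhB subee//; apply: integrable_fin_num => //; exact: integrableS ih.
rewrite integralE -[X in (X - _)%E]/(\int[P]_(w in Z @^-1` B) ((EFin \o Y)^\+ w))%E.
rewrite -[X in (_ - X)%E]/(\int[P]_(w in Z @^-1` B) ((EFin \o Y)^\- w))%E -YpE -YnE.
move/eqP; rewrite sube_eq ?add0e => [/eqP//||].
- rewrite YpE; apply: integrable_fin_num => //; exact: integrable_funepos.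
- by rewrite fin_num_adde_defr// YnE; apply: integrable_fin_num => //;
    exact: integrable_funeneg.
Qed.

(** From indicators to bounded functions: the defining property says that the
    positive and negative parts of [X - h (Z)], taken as densities, have the same
    image under [Z]; so they give the same integral to [phi]. *)
Lemma cond_expectation_mul (phi : R -> R) (M : R) : measurable_fun setT phi ->
  (forall x, 0 <= phi x <= M) ->
  (\int[P]_w (X w * phi (Z w))%:E = \int[P]_w (h (Z w) * phi (Z w))%:E)%E.
Proof.
move=> mphi phiM; case: (XZ) => mh iX ih _.
have mphiE : measurable_fun setT (EFin \o phi) by exact/measurable_EFinP.
have phi0 x : (0 <= (EFin \o phi) x)%E by rewrite lee_fin; case/andP: (phiM x).
have mphiZE : measurable_fun setT (fun w => (phi (Z w))%:E).
  exact: (measurableT_comp mphiE mZ).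
have phiZ0 w : (0 <= (phi (Z w))%:E)%E by exact: phi0.
have key : (\int[P]_w ((phi (Z w))%:E * (Yp w)%:E) =
            \int[P]_w ((phi (Z w))%:E * (Yn w)%:E))%E.
  rewrite -(@ge0_integral_density_measure _ _ _ _ _ mYp Yp0 (fun w => (phi (Z w))%:E))//.
  rewrite -(@ge0_integral_density_measure _ _ _ _ _ mYn Yn0 (fun w => (phi (Z w))%:E))//.
  transitivity (\int[image_measure (density_measure P mYp Yp0) mZ]_x (phi x)%:E)%E.
    by rewrite ge0_integral_pushforward// => x _; exact: phi0.
  rewrite (eq_measure_integral (image_measure (density_measure P mYn Yn0) mZ)).
    by rewrite ge0_integral_pushforward// => x _; exact: phi0.
  by move=> B mB _; exact: eq_parts.
have mphiZ : measurable_fun setT (fun w => phi (Z w)) by exact: (measurableT_comp mphi).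
have bphi w : `|phi (Z w)| <= M by case/andP: (phiM (Z w)) => p0 pM; rewrite ger0_norm.
have iYp : P.-integrable setT (EFin \o Yp) by rewrite YpE; exact: integrable_funepos.
have iYn : P.-integrable setT (EFin \o Yn) by rewrite YnE; exact: integrable_funeneg.
have iYpphi := integrableM_bounded iYp mphiZ bphi.
have iYnphi := integrableM_bounded iYn mphiZ bphi.
have iXphi := integrableM_bounded iX mphiZ bphi.
have ihphi := integrableM_bounded ih mphiZ bphi.
have : (\int[P]_w (X w * phi (Z w) - h (Z w) * phi (Z w))%:E = 0)%E.
  transitivity (\int[P]_w (Yp w * phi (Z w) - Yn w * phi (Z w))%:E)%E.
    apply: eq_integral => w _; congr EFin; rewrite -!mulrBl; congr (_ * _).
    by rewrite /Yp /Yn /Y !maxEle; repeat case: ifPn; rewrite -?ltNge; lra.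
  rewrite integralB_EFin//.
  under eq_integral do rewrite mulrC EFinM.
  under [X in (_ - X)%E]eq_integral do rewrite mulrC EFinM.
  rewrite key subee//.
  under eq_integral do rewrite muleC -EFinM.
  exact: integrable_fin_num.
rewrite integralB_EFin// => /eqP; rewrite sube_eq ?add0e => [/eqP//||].
- exact: integrable_fin_num.
- by rewrite fin_num_adde_defr//; exact: integrable_fin_num.
Qed.

End conditional_expectation.

(** * The coupling with the sum *)

Section collection_law.
Context (R : realType) (n : nat) (d : measure_display) (T : measurableType d)
  (P : probability T R) (X : 'I_n -> {RV P >-> R}) (W : T -> R).
Hypotheses (iX : forall i, P.-integrable [set: T] (EFin \o X i))
  (WE : W = fun w => \sum_(i < n) X i w).

Lemma measurable_tuple_RV : measurable_fun setT (fun w => [tuple X j w | j < n]).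
Proof.
apply/measurable_fun_tnthP => j.
rewrite (_ : _ \o _ = X j); first exact: measurable_funPT.
by apply/funext => w; exact: tnth_mktuple.
Qed.

Lemma integrable_sum_RV : P.-integrable setT (EFin \o W).
Proof.
have := integrable_sum measurableT (index_enum 'I_n) (P := xpredT) (fun i _ => iX i).
by rewrite WE; under eq_fun do rewrite sumEFin.
Qed.

(** [rest + x2] is [rest + x1] after the swap, and [rest + x1] is the sum of the
    entries of [drop2]. *)
Lemma same_law_sum_x2 (F : probability (n.+1.-tuple R) R) i :
  same_law F F id (swap i) ->
  same_law P F (fun w => [tuple X j w | j < n]) (drop2 i) ->
  same_law P F W (fun t => rest i t + x2 i t).
Proof.
move=> swapF PF A mA.
pose sumA : set (n.-tuple R) := [set s | A (\sum_(j < n) tnth s j)].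
have msumA : measurable sumA.
  rewrite -[sumA]setTI; apply: (@measurable_sum _ _ _ setT) => // j.
  exact: measurable_tnth.
have mdrop : measurable (drop2 i @^-1` sumA).
  by rewrite -[_ @^-1` _]setTI; exact: measurable_drop2.
transitivity (pushforward P (fun w => [tuple X j w | j < n]) sumA).
  have sE w : \sum_(j < n) tnth [tuple X j w | j < n] j = W w.
    by rewrite WE; apply: eq_bigr => j _; rewrite tnth_mktuple.
  by congr (P _); apply/seteqP; split => w; rewrite /sumA /= sE.
rewrite (PF _ msumA); have := swapF _ mdrop; rewrite /pushforward preimage_id => ->.
congr (F _); apply/seteqP; split => t;
  by rewrite /sumA /= sum_drop2 rest_swap x1_swap.
Qed.

Section moments.
Variables (phi : R -> R) (M : R).
Hypotheses (mphi : measurable_fun setT phi) (phiM : forall x, `|phi x| <= M).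

Let mphiW : measurable_fun setT (fun w => phi (W w)).
Proof.
apply: (measurableT_comp mphi).
by have /measurable_int/measurable_EFinP := integrable_sum_RV.
Qed.

Lemma integrable_RV_phi i : P.-integrable setT (EFin \o (fun w => X i w * phi (W w))).
Proof. by apply: (integrableM_bounded (iX i) mphiW (M := M)) => w; exact: phiM. Qed.

Lemma integral_sum_phi :
  (\int[P]_w (W w * phi (W w))%:E = \sum_(i < n) \int[P]_w (X i w * phi (W w))%:E)%E.
Proof.
rewrite -integral_sum//; last by move=> i; exact: integrable_RV_phi.
by apply: eq_integral => w _; rewrite sumEFin -mulr_suml {1}WE.
Qed.

Let g i (s : n.-tuple R) := (tnth s i * phi (\sum_(j < n) tnth s j))%:E.

Let mg i : measurable_fun setT (g i).
Proof.
apply/measurable_EFinP; apply: measurable_funM; first exact: measurable_tnth.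
apply: (measurableT_comp mphi); apply: measurable_sum => j; exact: measurable_tnth.
Qed.

Let gE i w : g i [tuple X j w | j < n] = (X i w * phi (W w))%:E.
Proof.
rewrite /g tnth_mktuple WE; congr (_ * phi _)%:E.
by apply: eq_bigr => j _; rewrite tnth_mktuple.
Qed.

Lemma integral_drop2_phi (F : probability (n.+1.-tuple R) R) i :
  same_law P F (fun w => [tuple X j w | j < n]) (drop2 i) ->
  (\int[F]_t (x1 i t * phi (rest i t + x1 i t))%:E =
   \int[P]_w (X i w * phi (W w))%:E)%E.
Proof.
move=> PF.
have := same_law_integral measurable_tuple_RV (@measurable_drop2 R n i) PF (@mg i).
under eq_integral do rewrite gE.
by move=> ->; apply: eq_integral => t _; rewrite /g sum_drop2 -x1_drop2.
Qed.

Lemma integral_exchangeable_phi i j : exchangeable P X ->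
  (\int[P]_w (X i w * phi (W w))%:E = \int[P]_w (X j w * phi (W w))%:E)%E.
Proof.
move=> exX; have ij := exX (tperm i j).
have mXs : measurable_fun setT (fun w => [tuple X (tperm i j k) w | k < n]).
  apply/measurable_fun_tnthP => k.
  rewrite (_ : _ \o _ = X (tperm i j k)); first exact: measurable_funPT.
  by apply/funext => w; exact: tnth_mktuple.
have := same_law_integral mXs measurable_tuple_RV ij (@mg j).
have -> : (\int[P]_w g j [tuple X k w | k < n] = \int[P]_w (X j w * phi (W w))%:E)%E.
  by apply: eq_integral => w _; rewrite gE.
move=> <-; apply: eq_integral => w _; rewrite /g tnth_mktuple tpermR WE.
congr (_ * phi _)%:E; rewrite (reindex_inj (@perm_inj _ (tperm i j))).
by apply: eq_bigr => k _; rewrite tnth_mktuple.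
Qed.

End moments.

Lemma integrable_x1 (F : probability (n.+1.-tuple R) R) i :
  same_law P F (fun w => [tuple X j w | j < n]) (drop2 i) ->
  F.-integrable setT (EFin \o x1 i).
Proof.
move=> PF.
have mt : measurable_fun setT (fun s : n.-tuple R => (tnth s i)%:E).
  by apply/measurable_EFinP; exact: measurable_tnth.
have := same_law_integrable measurable_tuple_RV (@measurable_drop2 R n i) PF mt.
rewrite (_ : _ \o (fun w => _) = EFin \o X i); last first.
  by apply/funext => w /=; rewrite tnth_mktuple.
rewrite (_ : _ \o drop2 i = EFin \o x1 i); first by apply; exact: iX.
by apply/funext => t /=; rewrite -x1_drop2.
Qed.

End collection_law.

Theorem theorem2p1 (R : realType) (n : nat)
    (d : measure_display) (T : measurableType d) (P : probability T R)
    (X : 'I_n -> {RV P >-> R}) (W : T -> R)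
    (X_integrable : forall i, P.-integrable [set: T] (EFin \o X i))
    (X_mean0 : forall i, ('E_P[X i] = 0)%E)
    (W_def : W = fun w => \sum_(i < n) X i w)
    (W2_integrable : P.-integrable [set: T] (EFin \o (fun w => W w ^+ 2)))
    (W2_neq0 : ('E_P[fun w => (W w ^+ 2)%R] <> 0)%E) :
  (forall (F : 'I_n -> probability (n.+1.-tuple R) R),
    (* (a) *)
    (forall i, same_law (F i) (F i) id (swap i)) ->
    (* (b) *)
    (forall i, same_law P (F i) (fun w => [tuple X j w | j < n]) (drop2 i)) ->
    (* (c) *)
    (exists rho : R, forall f : R -> R, measurable_fun [set: R] f ->
      P.-integrable [set: T] (EFin \o (fun w => W w * f (W w))) ->
      (forall i, (F i).-integrable [set: n.+1.-tuple R]
         (EFin \o (fun t => x1 i t * f (rest i t + x2 i t)))) ->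
      (\sum_(i < n) 'E_(F i)[fun t => (x1 i t * f (rest i t + x2 i t))%R]
       = rho%:E * 'E_P[fun w => (W w * f (W w))%R])%E) ->
    (* the v_i^2 are finite *)
    (forall i, (F i).-integrable [set: n.+1.-tuple R]
       (EFin \o (fun t => (x1 i t - x2 i t) ^+ 2))) ->
    forall (d' : measure_display) (T' : measurableType d')
      (P' : probability T' R) (I : T' -> 'I_n) (U : {RV P' >-> R})
      (Xh : 'I_n -> {RV P' >-> n.+1.-tuple R}),
    (forall i, measurable (I @^-1` [set i])) ->
    (forall i, P' (I @^-1` [set i])
       = (vsq (F i) i / \sum_(j < n) vsq (F j) j)%:E) ->
    (forall i, 0 < vsq (F i) i -> forall A, measurable A ->
       pushforward P' (Xh i) A = hat_law (F i) i A) ->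
    (forall A, measurable A ->
       pushforward P' U A = uniform_prob (@ltr01 R) A) ->
    (* I is independent of the X's; U is independent of the X's and I *)
    indep_systems P' (preimage_set_system setT I setT) (g_sigma_preimage Xh) ->
    indep_systems P' (preimage_set_system setT U measurable)
      <<s preimage_set_system setT I setT `|` g_sigma_preimage Xh >> ->
    zero_biased P P' W (fun w => mix (I w) (U w) (Xh (I w) w)))
  /\
  (forall i1 : 'I_n, i1 = 0%N :> nat ->
    exchangeable P X ->
    forall (F : probability (n.+1.-tuple R) R),
    exchangeable F (fun k t => tnth t k) ->
    (* 0 < v_1^2 < +oo *)
    F.-integrable [set: n.+1.-tuple R]
      (EFin \o (fun t => (x1 i1 t - x2 i1 t) ^+ 2)) ->
    0 < vsq F i1 ->
    same_law P F (fun w => [tuple X j w | j < n]) (drop2 i1) ->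
    (exists rho : R, is_cond_expectation F (x1 i1)
       (fun t => rest i1 t + x2 i1 t) (fun x => rho / n%:R * x)) ->
    forall (d' : measure_display) (T' : measurableType d')
      (P' : probability T' R) (U : {RV P' >-> R})
      (Xh : {RV P' >-> n.+1.-tuple R}),
    (forall A, measurable A -> pushforward P' Xh A = hat_law F i1 A) ->
    (forall A, measurable A ->
       pushforward P' U A = uniform_prob (@ltr01 R) A) ->
    indep_systems P' (preimage_set_system setT U measurable)
      (preimage_set_system setT Xh measurable) ->
    zero_biased P P' W (fun w => mix i1 (U w) (Xh w))).
Proof.
have iW := integrable_sum_RV X_integrable W_def.
have mW : measurable_fun setT W by apply/measurable_EFinP; exact: measurable_int iW.
have EW0 : (\int[P]_w (W w)%:E = 0)%E.
  rewrite W_def; under eq_integral do rewrite -sumEFin.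
  rewrite integral_sum// big1// => i _.
  by have := X_mean0 i; rewrite unlock.
split.
(* here kappa is [2 (1 - rho)], the 2 coming from the symmetry of each pair and
   [1 - rho] from (b) and (c) *)
- move=> F swapF dropF [rho Hrho] iv d' T' P' I U Xh mI PI lawX lawU indI indU.
  pose S := \sum_(j < n) vsq (F j) j.
  have v0 i : 0 <= vsq (F i) i by exact: vsq_ge0.
  have S0 : 0 < S.
    rewrite lt_neqAle sumr_ge0// andbT; apply/eqP => S00.
    have := measure_sum_fibers P' mI measurableT.
    rewrite probability_setT big1 => [/eqP|i _]; first by rewrite onee_eq0.
    by rewrite setIT PI -/S -S00 invr0 mulr0.
  have mWi i : measurable_fun setT (fun w => mix i (U w) (Xh i w)).
    by apply: measurable_mix_comp; exact: measurable_funPT.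
  have fiberE i (B : set R) :
      I @^-1` [set i] `&` ((fun w => mix (I w) (U w) (Xh (I w) w)) @^-1` B) =
      I @^-1` [set i] `&` ((fun w => mix i (U w) (Xh i w)) @^-1` B).
    by apply/seteqP; split => w [/= -> ?].
  have mWs : measurable_fun setT (fun w => mix (I w) (U w) (Xh (I w) w)).
    move=> _ B mB; rewrite setTI.
    rewrite (_ : _ @^-1` B = \big[setU/set0]_(i < n) (I @^-1` [set i] `&`
        ((fun w => mix (I w) (U w) (Xh (I w) w)) @^-1` B))).
      apply: bigsetU_measurable => i _; rewrite fiberE; apply: measurableI => //.
      by rewrite -[_ @^-1` _]setTI; exact: mWi.
    rewrite -bigcup_seq; apply/seteqP; split => w /=.
      by move=> Ew; exists (I w) => //=; rewrite mem_index_enum.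
    by move=> [i _ []].
  apply: (@zero_biased_of_itv _ _ _ _ _ _ _ _ _ mW mWs iW EW0 W2_integrable
    S (2 * (1 - rho)) S0).
  move=> a b ab.
  pose M i := (\int[F i]_t ((x1 i t - x2 i t) *
     (ramp a b (rest i t + x1 i t) - ramp a b (rest i t + x2 i t)))%:E)%E.
  have PM i : (S%:E * P' (I @^-1` [set i] `&`
      ((fun w => mix (I w) (U w) (Xh (I w) w)) @^-1` `]a, b])) = M i)%E.
    rewrite fiberE; have [vi0|vi0] := ltP 0 (vsq (F i) i).
      have ind A C : measurable A -> measurable C ->
          P' (I @^-1` [set i] `&` (U @^-1` A `&` Xh i @^-1` C)) =
          ((vsq (F i) i / S)%:E * (uniform_prob (@ltr01 R) A * P' (Xh i @^-1` C)))%E.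
        move=> mA mC.
        have mX : <<s preimage_set_system setT I setT `|` g_sigma_preimage Xh >>
            (I @^-1` [set i] `&` Xh i @^-1` C).
          apply: (@measurableI _ (g_sigma_algebraType _)).
            apply: sub_sigma_algebra; left; exists [set i] => //; exact: setTI.
          apply: sub_sigma_algebra; right; apply: sub_sigma_algebra.
          rewrite -bigcup_seq; exists i; first by rewrite /= mem_index_enum.
          by exists C => //; exact: setTI.
        have -> : I @^-1` [set i] `&` (U @^-1` A `&` Xh i @^-1` C) =
            U @^-1` A `&` (I @^-1` [set i] `&` Xh i @^-1` C) by rewrite setICA.
        rewrite (indU _ _ _ mX); last by exists A => //; exact: setTI.
        rewrite -[P' (U @^-1` A)]/(pushforward P' U A) lawU// muleCA; congr (_ * _)%E.
        rewrite indI ?PI//; first by exists [set i] => //; exact: setTI.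
        apply: sub_sigma_algebra.
        rewrite -bigcup_seq; exists i; first by rewrite /= mem_index_enum.
        by exists C => //; exact: setTI.
      have := law_mix (iv i) (mI i) vi0 (lawX i vi0) ind ab.
      rewrite (_ : [set w | _] = (fun w => mix i (U w) (Xh i w)) @^-1` `]a, b])//.
      move=> ->; rewrite !muleA -!EFinM mulrCA mulfV ?gt_eqF// mulr1.
      by rewrite mulfV ?gt_eqF// mul1e.
    (* a degenerate pair is never selected, and contributes nothing to the sum *)
    have vi : vsq (F i) i = 0 by apply/eqP; rewrite eq_le vi0 v0.
    have PI0 : P' (I @^-1` [set i]) = 0%E by rewrite PI vi mul0r.
    rewrite (_ : P' _ = 0%E) ?mule0; last first.
      apply: (subset_measure0 _ (mI i) _ PI0); last by move=> w [].
      by apply: measurableI => //; exact: measurable_preimage_itv.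
    apply/esym/eqP; rewrite eq_le; apply/andP; split; last first.
      apply: integral_ge0 => t _; rewrite lee_fin.
      by have /andP[] := ramp_pair_bound_tuple i t ab.
    rewrite -[leRHS]/(0%:E) -vi (vsqE (iv i)); apply: ge0_le_integral => //.
    - by move=> t _; rewrite lee_fin; have /andP[] := ramp_pair_bound_tuple i t ab.
    - exact: measurable_ramp_pair.
    - exact: measurable_int (iv i).
    - by move=> t _; rewrite lee_fin; have /andP[] := ramp_pair_bound_tuple i t ab.
  have mE : measurable ((fun w => mix (I w) (U w) (Xh (I w) w)) @^-1` `]a, b]).
    exact: measurable_preimage_itv mWs.
  rewrite (measure_sum_fibers P' mI mE) ge0_sume_distrr//.
  under eq_bigr do rewrite PM.
  have mr := measurable_ramp a b.
  have br x := @ramp_norm_le R a b x ab.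
  have ix1 i := integrable_x1 X_integrable (dropF i).
  have e1fin i : (\int[P]_w (X i w * ramp a b (W w))%:E)%E \is a fin_num.
    apply: integrable_fin_num => //.
    exact: (integrable_RV_phi X_integrable W_def mr br).
  have e2fin i :
      (\int[F i]_t (x1 i t * ramp a b (rest i t + x2 i t))%:E)%E \is a fin_num.
    by apply: integrable_fin_num => //; exact: (integrable_x1_phi2 (ix1 i) mr br).
  transitivity (\sum_(i < n) 2%:E * (\int[P]_w (X i w * ramp a b (W w))%:E
      - \int[F i]_t (x1 i t * ramp a b (rest i t + x2 i t))%:E))%E.
    apply: eq_bigr => i _.
    rewrite /M (integral_exchangeable_pair (swapF i) (ix1 i) mr br).
    by rewrite (integral_drop2_phi W_def mr (dropF i)).
  have iWr : P.-integrable setT (EFin \o (fun w => W w * ramp a b (W w))).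
    apply: (integrableM_bounded iW) => [|w]; last exact: br.
    exact: (measurableT_comp mr).
  have := Hrho _ mr iWr (fun i => integrable_x1_phi2 (ix1 i) mr br).
  rewrite expectationE => cc.
  have eW := integral_sum_phi X_integrable W_def mr br.
  pose r1 i := fine (\int[P]_w (X i w * ramp a b (W w))%:E)%E.
  pose r2 i := fine (\int[F i]_t (x1 i t * ramp a b (rest i t + x2 i t))%:E)%E.
  have r1E i : (\int[P]_w (X i w * ramp a b (W w))%:E = (r1 i)%:E)%E.
    by rewrite /r1 fineK.
  have r2E i : (\int[F i]_t (x1 i t * ramp a b (rest i t + x2 i t))%:E = (r2 i)%:E)%E.
    by rewrite /r2 fineK.
  move: cc; rewrite eW.
  under eq_bigr do rewrite expectationE r2E.
  under [X in (_ * X)%E]eq_bigr do rewrite r1E.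
  rewrite !sumEFin -EFinM => -[cc].
  under eq_bigr do rewrite r1E r2E -EFinB -EFinM.
  under [X in _ = (_ * X)%E]eq_bigr do rewrite r1E.
  rewrite !sumEFin -EFinM; congr EFin.
  by rewrite -mulr_sumr sumrB cc; ring.
- move=> i i0 exX F exF iv v0 PF [rho cond] d' T' P' U Xh lawX lawU indU.
  (* the general argument with a single pair: exchangeability replaces the sum over
     the pairs by a factor n *)
  have n0 : n%:R != 0 :> R by rewrite pnatr_eq0 -lt0n (leq_ltn_trans _ (ltn_ord i)).
  have swapF : same_law F F id (swap i).
    move=> A mA; have := exF (tperm (pos1 i) (pos2 i)) A mA.
    move=> e; rewrite -[RHS]/(pushforward F (fun t => swap i t) A) [RHS]e.
    congr (pushforward F _ A); apply/funext => t; apply: eq_from_tnth => k.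
    by rewrite tnth_mktuple.
  have ix1 := integrable_x1 X_integrable PF.
  have mWs : measurable_fun setT (fun w => mix i (U w) (Xh w)).
    by apply: measurable_mix_comp; exact: measurable_funPT.
  apply: (@zero_biased_of_itv _ _ _ _ _ _ _ _ _ mW mWs iW EW0 W2_integrable
    (vsq F i) (2 * (1 - rho) / n%:R) v0).
  move=> a b ab.
  have mr := measurable_ramp a b.
  have br x := @ramp_norm_le R a b x ab.
  have ind A C : measurable A -> measurable C ->
      P' (setT `&` (U @^-1` A `&` Xh @^-1` C)) =
      (1%:E * (uniform_prob (@ltr01 R) A * P' (Xh @^-1` C)))%E.
    move=> mA mC; rewrite setTI mul1e indU.
    - by rewrite -[P' (U @^-1` A)]/(pushforward P' U A) lawU.
    - by exists A => //; exact: setTI.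
    - by exists C => //; exact: setTI.
  have := law_mix iv measurableT v0 lawX ind ab.
  rewrite setTI mul1e.
  rewrite (_ : [set w | _] = (fun w => mix i (U w) (Xh w)) @^-1` `]a, b])//.
  move=> ->; rewrite muleA -EFinM mulfV ?gt_eqF// mul1e.
  rewrite (integral_exchangeable_pair swapF ix1 mr br).
  rewrite (integral_drop2_phi W_def mr PF).
  have eX j := integral_exchangeable_phi W_def mr j i exX.
  have eW : (\int[P]_w (W w * ramp a b (W w))%:E =
      n%:R%:E * \int[P]_w (X i w * ramp a b (W w))%:E)%E.
    rewrite (integral_sum_phi X_integrable W_def mr br).
    rewrite (eq_bigr _ (fun j _ => eX j)) sumr_const card_ord.
    by rewrite mule_natl.
  pose Z (t : n.+1.-tuple R) := rest i t + x2 i t.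
  have mZ : measurable_fun setT Z.
    by apply: measurable_funD; [exact: measurable_rest|exact: measurable_x2].
  have WZ : same_law P F W Z by exact: (same_law_sum_x2 W_def swapF PF).
  have eZ : (\int[F]_t (Z t * ramp a b (Z t))%:E =
      \int[P]_w (W w * ramp a b (W w))%:E)%E.
    have mg : measurable_fun setT (fun x : R => (x * ramp a b x)%:E).
      by apply/measurable_EFinP; apply: measurable_funM.
    exact/esym/(same_law_integral mW mZ WZ mg).
  have iWr : P.-integrable setT (EFin \o (fun w => W w * ramp a b (W w))).
    apply: (integrableM_bounded iW) => [|w]; last exact: br.
    exact: (measurableT_comp mr).
  have iZr : F.-integrable setT (fun t => (Z t * ramp a b (Z t))%:E).
    have mg : measurable_fun setT (fun x : R => (x * ramp a b x)%:E).
      by apply/measurable_EFinP; apply: measurable_funM.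
    exact: (same_law_integrable mW mZ WZ mg iWr).
  have eC : (\int[F]_t (x1 i t * ramp a b (Z t))%:E =
      (rho / n%:R)%:E * \int[P]_w (W w * ramp a b (W w))%:E)%E.
    rewrite (cond_expectation_mul mZ cond mr (fun x => ramp_bound x ab)) -eZ.
    rewrite -integralZl//.
    by apply: eq_integral => t _; rewrite -EFinM mulrA.
  have e1fin : (\int[P]_w (X i w * ramp a b (W w))%:E)%E \is a fin_num.
    apply: integrable_fin_num => //.
    exact: (integrable_RV_phi X_integrable W_def mr br).
  have [r rE] : exists r, (\int[P]_w (X i w * ramp a b (W w))%:E = r%:E)%E.
    by exists (fine (\int[P]_w (X i w * ramp a b (W w))%:E)%E); rewrite fineK.
  rewrite eC eW rE -!EFinM; congr EFin.
  by field.
Qed.
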